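(* The Hamiltonian $$H=\sum_{v} h_v+\sum_{(P,Q)} h_{PQ}$$ on the honeycomb lattice on the torus, where the first sum runs over all vertices and the second over all pairs of adjacent hexagons, has a $9$-fold degenerate ground space, spanned by the trimer state and its topologically equivalent siblings $$|\Psi_{\nu_h,\nu_v}\rangle=\sum_{L\in\mathcal L}\omega^{\nu_hN_h(L)+\nu_vN_v(L)}\,\zeta^{N^A_{222}(L)+N^B_{111}(L)}\,|L\rangle ,\qquad \nu_h,\nu_v\in\{0,1,2\},\ \omega=e^{2\pi i/3}$$ (the trimer state being the one with $\nu_h=\nu_v=0$).
   Context: Torus. The hexagons (plaquettes) of the honeycomb lattice on the torus are labelled by $p\in\mathbb Z_m\times\mathbb Z_n$; with $a_1=(1,0)$, $a_2=(0,1)$, two hexagons are adjacent iff they differ by $\pm a_1$, $\pm a_2$ or $\pm(a_1-a_2)$. The vertices are the $A$ vertices, one for each triple of hexagons $\{p,p+a_1,p+a_2\}$, and the $B$ vertices, one for each triple $\{p+a_1,p+a_2,p+a_1+a_2\}$. The edges are the pairs of adjacent hexagons (the edge separating them); an edge is incident to a vertex iff both its hexagons belong to the vertex's triple, so each edge joins one $A$ and one $B$ vertex and each vertex has three incident edges. An edge belongs to a hexagon if the hexagon is one of its two hexagons. Hilbert space. Each edge carries $\mathbb C^3$ with orthonormal basis labelled by $\mathbb Z_3=\{0,1,2\}$; the total space is the tensor product over edges, with basis $|L\rangle$, $L$ a map from edges to $\mathbb Z_3$. A vertex configuration (values of the three incident edges) is allowed if the three values sum to $0$ in $\mathbb Z_3$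 (Gauss law) and are not all equal to $0$. $\mathcal L$ is the set of all $L$ for which every vertex configuration is allowed (these encode coverings of the kagome lattice by trimers). $N^A_{222}(L)$ (resp. $N^B_{111}(L)$) is the number of $A$ vertices all of whose edges have value $2$ (resp. $B$ vertices all of whose edges have value $1$); these vertices correspond to folded trimers, i.e. trimers on a single triangle, and $\zeta$ is the weight assigned to folded trimers. $N_h(L)\in\mathbb Z_3$ and $N_v(L)\in\mathbb Z_3$ are the sums of the edge values along a horizontal, respectively vertical, loop around the torus, i.e. over the edges $\{(i,0),(i+1,0)\}$, $i\in\mathbb Z_m$, respectively $\{(0,j),(0,j+1)\}$, $j\in\mathbb Z_n$. Hamiltonian terms. $h_v$ is the projector acting on the three edges at $v$ whose ground space (kernel) is spanned by the allowed vertex configurations. For a pair of adjacent hexagons $P,Q$, $h_{PQ}$ is a projector acting on the $11$ edges belonging to $P$ or $Q$. These edges touch $10$ vertices, $8$ of which have exactly one further incident edge (outer leg) not among the $11$ edges. For each choice $r\in\mathbb Z_3^8$ of values of the outer legs, let $X_r$ be the set of assignments $x$ of $\mathbb Z_3$ values to the $11$ edges such that, together with $r$, all $10$ vertex configurations are allowed, and let $w(x)=\zeta^{k}$, where $k$ is the number of $A$ vertices in configuration $222$ plus the number of $B$ vertices in configuration $111$ among these $10$ vertices. The kernel of $h_{PQ}$ is spanned by the superpositions $\sum_{x\in X_r}w(x)|x\rangle$ of all allowed configurations consistent with the surrounding values $r$, one for each $r$. (The values $r$ are determined by $x$ through the Gauss law, so $h_{PQ}$ need not act on the outer legs.)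
   Formalization: The weight ζ of folded trimers is assumed nonzero: for ζ=0 the claim fails (on the 3×3 torus six frozen configurations with N_h=N_v=0 are each ground states). The torus has m,n≥3, as the stated lattice incidences require. *)

(* Defs.v *)
From HB Require Import structures.
From mathcomp Require Import all_boot all_order all_algebra.
From mathcomp Require Import spectral complex reals trigo.

Set Implicit Arguments.
Unset Strict Implicit.
Unset Printing Implicit Defensive.

Import Order.TTheory GRing.Theory Num.Theory.
Local Open Scope ring_scope.

(* MathComp / MathComp-Analysis; the complex numbers are R[i] for R : realType.
   'Z_m is Z/mZ only for 1 < m, and the pairs and triples below describe the
   honeycomb lattice (three edges per vertex, two vertices per edge) exactly
   when 2 < m and 2 < n. *)

Definition hexagon (m n : nat) : finType := ('Z_m * 'Z_n)%type.

Definition a1 {m n : nat} : 'Z_m * 'Z_n := (1, 0).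
Definition a2 {m n : nat} : 'Z_m * 'Z_n := (0, 1).

Definition adjacent (m n : nat) (p q : 'Z_m * 'Z_n) : bool :=
  q - p \in [:: a1; - a1; a2; - a2; a1 - a2; - (a1 - a2)].

Definition is_edge (m n : nat) (e : {set hexagon m n}) : bool :=
  [exists p, exists q, adjacent p q && (e == [set p; q])].

Definition edge (m n : nat) : finType := {e : {set hexagon m n} | is_edge e}.

(* [inl p] is the A vertex based at p, [inr p] the B vertex based at p. *)
Definition vertex (m n : nat) : finType := (hexagon m n + hexagon m n)%type.

Definition triple (m n : nat) (v : vertex m n) : {set hexagon m n} :=
  match v with
  | inl p => [set p; p + a1; p + a2]
  | inr p => [set p + a1; p + a2; p + a1 + a2]
  end.

Definition star (m n : nat) (v : vertex m n) : {set edge m n} :=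
  [set e : edge m n | val e \subset triple v].

Definition config (m n : nat) : finType := {ffun edge m n -> 'Z_3}.

Definition local_config (m n : nat) (S : {set edge m n}) : finType :=
  {ffun {e | e \in S} -> 'Z_3}.

Definition restrict (m n : nat) (S : {set edge m n}) (L : config m n) :
  local_config S := [ffun e => L (val e)].

(* The common extension of x and r for disjoint S and T; the value 0 outside
   of S and T is a dummy. *)
Definition glue (m n : nat) (S T : {set edge m n})
    (x : local_config S) (r : local_config T) : config m n :=
  [ffun e => if insub e is Some u then x u
             else if insub e is Some u then r u else 0].

Definition allowed (m n : nat) (L : config m n) (v : vertex m n) : bool :=
  (\sum_(e in star v) L e == 0) && ~~ [forall e in star v, L e == 0].

(* Configuration 222 at an A vertex, 111 at a B vertex. *)
Definition folded (m n : nat) (L : config m n) (v : vertex m n) : bool :=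
  match v with
  | inl _ => [forall e in star v, L e == 2]
  | inr _ => [forall e in star v, L e == 1]
  end.

(* An unordered pair of adjacent hexagons {P, Q} is the edge separating them. *)
Definition inner (m n : nat) (PQ : edge m n) : {set edge m n} :=
  [set e : edge m n | val e :&: val PQ != set0].

Definition touched (m n : nat) (PQ : edge m n) : {set vertex m n} :=
  [set v | star v :&: inner PQ != set0].

Definition outer_legs (m n : nat) (PQ : edge m n) : {set edge m n} :=
  (\bigcup_(v in touched PQ) star v) :\: inner PQ.

(* Row vectors over F whose coordinates are indexed by a finite type T; an
   operator M acts on a state u as u *m M. *)
Definition states (F : Type) (T : finType) := 'rV[F]_#|T|.
Definition operators (F : Type) (T : finType) := 'M[F]_#|T|.

(* The state \sum_x c x |x>. *)
Definition superposition (F : Type) (T : finType) (c : T -> F) : states F T :=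
  \row_i c (enum_val i).

Definition ket (F : nzRingType) (T : finType) (x : T) : states F T :=
  superposition (fun y => (y == x)%:R).

(* The orthogonal projector with kernel the row space of K. *)
Definition projector_with_kernel (C : numClosedFieldType) (N : nat)
  (K : 'M[C]_N) : 'M[C]_N := 1%:M - proj_ortho K.

(* h acting on the edges of S, tensored with the identity on all others. *)
Definition act_on (F : nzRingType) (m n : nat) (S : {set edge m n})
    (h : operators F (local_config S)) : operators F (config m n) :=
  \matrix_(i, j)
    let L : config m n := enum_val i in
    let L' : config m n := enum_val j in
    if [forall e, (e \notin S) ==> (L e == L' e)]
    then h (enum_rank (restrict S L)) (enum_rank (restrict S L')) else 0.

Definition vertex_kernel (F : fieldType) (m n : nat) (v : vertex m n) :
    operators F (local_config (star v)) :=
  (\sum_(x : local_config (star v)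
           | allowed (glue x ([ffun=> 0] : local_config set0)) v)
     <<ket F x>>)%MS.

Definition vertex_term (C : numClosedFieldType) (m n : nat) (v : vertex m n) :
    operators C (config m n) :=
  act_on (projector_with_kernel (vertex_kernel C v)).

Definition pair_state (F : fieldType) (m n : nat) (zeta : F) (PQ : edge m n)
    (r : local_config (outer_legs PQ)) : states F (local_config (inner PQ)) :=
  superposition (fun x : local_config (inner PQ) =>
    let L := glue x r in
    if [forall v in touched PQ, allowed L v]
    then zeta ^+ #|[set v in touched PQ | folded L v]| else 0).

Definition pair_kernel (F : fieldType) (m n : nat) (zeta : F) (PQ : edge m n) :
    operators F (local_config (inner PQ)) :=
  (\sum_(r : local_config (outer_legs PQ)) <<pair_state zeta r>>)%MS.

Definition pair_term (C : numClosedFieldType) (m n : nat) (zeta : C)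
    (PQ : edge m n) : operators C (config m n) :=
  act_on (projector_with_kernel (pair_kernel zeta PQ)).

Definition hamiltonian (C : numClosedFieldType) (m n : nat) (zeta : C) :
    operators C (config m n) :=
  \sum_(v : vertex m n) vertex_term C v
  + \sum_(PQ : edge m n) pair_term zeta PQ.

(* On R[i], [E <= E'] means that E' - E is a nonnegative real. *)
Definition ground_energy (C : numClosedFieldType) (N : nat) (H : 'M[C]_N)
    (E : C) : Prop :=
  eigenvalue H E /\ (forall E' : C, eigenvalue H E' -> E <= E').

Definition N_h (m n : nat) (L : config m n) : 'Z_3 :=
  \sum_(e : edge m n | [exists i : 'Z_m, val e == [set (i, 0); (i + 1, 0)]]) L e.

Definition N_v (m n : nat) (L : config m n) : 'Z_3 :=
  \sum_(e : edge m n | [exists j : 'Z_n, val e == [set (0, j); (0, j + 1)]]) L e.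

Definition omega (R : realType) : R[i] :=
  Complex (cos (2 * pi / 3)) (sin (2 * pi / 3)).

Definition Psi (R : realType) (m n : nat) (zeta : R[i]) (nu_h nu_v : 'I_3) :
    states R[i] (config m n) :=
  superposition (fun L : config m n =>
    if [forall v, allowed L v]
    then omega R ^+ (nu_h * N_h L + nu_v * N_v L)
         * zeta ^+ (#|[set p | folded L (inl p)]| + #|[set p | folded L (inr p)]|)
    else 0).

Arguments hamiltonian {C} m n zeta.
Arguments Psi {R} m n zeta nu_h nu_v.

(* Main.v *)
Require Import Defs.
From HB Require Import structures.
From mathcomp Require Import all_boot all_order all_algebra.
From mathcomp Require Import spectral complex reals trigo.
From mathcomp Require Import ring lra zify.
Import Defs.

Set Implicit Arguments.
Unset Strict Implicit.
Unset Printing Implicit Defensive.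

Import Order.TTheory GRing.Theory Num.Theory.

(** Every term of the Hamiltonian is an orthogonal projector, so the ground
    energy is 0 as soon as the kernels have a nonzero common vector, and the
    ground space is their intersection.  A state lies in it iff it vanishes off
    the allowed configurations and, after division by [zeta ^+ folds L], its
    amplitude does not change when an allowed configuration is modified inside
    two adjacent hexagons.  The theorem thus says that the orbits of these pair
    moves are exactly the nine sectors of fixed [(N_h, N_v)].

    Locally an edge value is the difference of the [Z_3] heights of its two
    hexagons, and a vertex is allowed iff its three heights are not all equal.
    Pair moves recolor two adjacent sites of the triangular lattice.  Every
    coloring is first moved to one without a monochromatic [a2]-edge: a search
    of a 5 x 5 window shows that near such an edge some pair move lowers their
    number.  Each triangle has exactly one [a2]-edge, so in the remaining
    colorings the columns [{i} x Z_n] are independent, and each column is a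
    proper coloring of a cycle, which vertical pair moves recolor greedily. *)

(** * Pair moves in a 5 x 5 window *)

Section Window.

Definition site := (nat * nat)%type.

Definition flatA (c : site -> nat) (x : site) :=
  (c x == c (x.1.+1, x.2)) && (c x == c (x.1, x.2.+1)).
Definition flatB (c : site -> nat) (x : site) :=
  (c (x.1.+1, x.2) == c (x.1, x.2.+1))
  && (c (x.1, x.2.+1) == c (x.1.+1, x.2.+1)).
Definition flatV (c : site -> nat) (x : site) := c x == c (x.1, x.2.+1).

Definition cornersA (x : site) := [:: x; (x.1.+1, x.2); (x.1, x.2.+1)].
Definition cornersB (x : site) :=
  [:: (x.1.+1, x.2); (x.1, x.2.+1); (x.1.+1, x.2.+1)].

Definition basesA (P : site) := [:: P; (P.1.-1, P.2); (P.1, P.2.-1)].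
Definition basesB (P : site) :=
  [:: (P.1.-1, P.2); (P.1, P.2.-1); (P.1.-1, P.2.-1)].
Definition basesV (P : site) := [:: P; (P.1, P.2.-1)].

Definition bases2 (f : site -> seq site) (P Q : site) := undup (f P ++ f Q).

Definition recolor (c : site -> nat) (P Q : site) (a b : nat) (x : site) :=
  if x == P then a else if x == Q then b else c x.

Definition improves (c : site -> nat) (P Q : site) (a b : nat) :=
  [&& all (fun x => ~~ flatA (recolor c P Q a b) x) (bases2 basesA P Q),
      all (fun x => ~~ flatB (recolor c P Q a b) x) (bases2 basesB P Q)
    & count (flatV (recolor c P Q a b)) (bases2 basesV P Q)
      < count (flatV c) (bases2 basesV P Q)].

Definition event := (site + site + site * site * (nat * nat))%type.
Notation FlatA x := (inl (inl x)).
Notation FlatB x := (inl (inr x)).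
Notation Improve P Q a b := (inr (P, Q, (a, b))).

Definition fires (c : site -> nat) (e : event) :=
  match e with
  | FlatA x => flatA c x
  | FlatB x => flatB c x
  | Improve P Q a b => improves c P Q a b
  end.

Definition event_support (e : event) : seq site :=
  match e with
  | FlatA x => cornersA x
  | FlatB x => cornersB x
  | Improve P Q a b =>
      flatten (map cornersA (bases2 basesA P Q))
      ++ flatten (map cornersB (bases2 basesB P Q))
      ++ flatten (map cornersA (bases2 basesV P Q))
  end.

Lemma fires_local (c c' : site -> nat) (e : event) :
  {in event_support e, c =1 c'} -> fires c e = fires c' e.
Proof.
have flatA_eq (d d' : site -> nat) x :
    {in cornersA x, d =1 d'} -> flatA d x = flatA d' x.
  by move=> dE; rewrite /flatA !dE ?inE ?eqxx ?orbT.
have flatB_eq (d d' : site -> nat) x :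
    {in cornersB x, d =1 d'} -> flatB d x = flatB d' x.
  by move=> dE; rewrite /flatB !dE ?inE ?eqxx ?orbT.
have flatV_eq (d d' : site -> nat) x :
    {in cornersA x, d =1 d'} -> flatV d x = flatV d' x.
  by move=> dE; rewrite /flatV !dE ?inE ?eqxx ?orbT.
case: e => [[x|x]|[[P Q] [a b]]] cE; [exact: flatA_eq | exact: flatB_eq |].
have cE' : {in event_support (Improve P Q a b),
    recolor c P Q a b =1 recolor c' P Q a b}.
  by move=> x xS; rewrite /recolor; case: eqP => // _; case: eqP => // _;
    exact: cE.
rewrite /= /improves; congr [&& _, _ & _ < _].
- apply: eq_in_all => x xP; congr (~~ _); apply: flatA_eq => y yx.
  by apply: cE'; rewrite mem_cat; apply/orP; left; apply/flatten_mapP; exists x.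
- apply: eq_in_all => x xP; congr (~~ _); apply: flatB_eq => y yx.
  apply: cE'; rewrite !mem_cat; apply/orP; right; apply/orP; left.
  by apply/flatten_mapP; exists x.
- apply: eq_in_count => x xP; apply: flatV_eq => y yx.
  apply: cE'; rewrite !mem_cat; apply/orP; right; apply/orP; right.
  by apply/flatten_mapP; exists x.
- apply: eq_in_count => x xP; apply: flatV_eq => y yx.
  apply: cE; rewrite !mem_cat; apply/orP; right; apply/orP; right.
  by apply/flatten_mapP; exists x.
Qed.

(* The monochromatic edge to be removed joins (2, 2) and (2, 3); the sites are
   listed in an window in which the search below prunes early. *)
Definition window : seq site :=
  [:: (2,2); (2,3); (3,2); (1,3); (2,1); (1,2); (1,4); (2,4); (3,1); (3,3);
      (4,2); (4,1); (0,4); (0,3); (0,2); (1,1); (3,0); (4,0); (4,4); (0,0);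
      (3,4); (0,1); (2,0); (1,0); (4,3)].

(* The tabulated inverse of [window]; lookups through it keep the search cheap. *)
Definition window_ranks : seq (seq nat) :=
  [seq [seq index (i, j) window | j <- iota 0 5] | i <- iota 0 5].

Definition window_pairs : seq (site * site) :=
  [seq pq <- flatten [seq [:: (p, (p.1.+1, p.2)); (p, (p.1, p.2.+1));
                              (p, (p.1.-1, p.2.+1))]
                     | p <- [seq (i, j) | i <- iota 1 3, j <- iota 1 3]]
  | [&& 0 < pq.2.1, pq.2.1 < 4 & pq.2.2 < 4]].

Definition window_events : seq event :=
  [seq FlatA (i, j) : event | i <- iota 0 4, j <- iota 0 4]
  ++ [seq FlatB (i, j) : event | i <- iota 0 4, j <- iota 0 4]
  ++ flatten [seq [seq Improve pq.1 pq.2 a b : event | a <- iota 0 3, b <- iota 0 3]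
             | pq <- window_pairs].

Lemma mem_window_events_improve P Q a b : Improve P Q a b \in window_events ->
  [/\ (P, Q) \in window_pairs, a < 3 & b < 3].
Proof.
rewrite mem_cat => /orP[/allpairsPdep[? [? []]]//|].
rewrite mem_cat => /orP[/allpairsPdep[? [? []]]//|].
case/flatten_mapP => -[P' Q'] PQ' /allpairsPdep[i [j []]].
by rewrite !mem_iota => i3 j3 [-> -> -> ->].
Qed.

Definition lookup (rk : seq (seq nat)) (x : site) := nth 0 (nth [::] rk x.1) x.2.

(* The default 3 is no color: it marks the sites not assigned yet. *)
Definition paint (rk : seq (seq nat)) (l : seq nat) (x : site) :=
  nth 3 l (lookup rk x).

(* The test goes through [find] because [has] and [||] evaluate both of their
   arguments under call by value, which would defeat the pruning. *)
Fixpoint refutes (rk : seq (seq nat)) (window_levels : seq (seq event)) (l : seq nat) :=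
  if window_levels is es :: levels' then
    all (fun a => let l' := rcons l a in
           if find (fires (paint rk l')) es < size es then true
           else refutes rk levels' l') [:: 0; 1; 2]
  else false.

Fixpoint timely (rk : seq (seq nat)) (window_levels : seq (seq event)) (k : nat) :=
  if window_levels is es :: levels' then
    all (fun e => all (fun x => lookup rk x <= k) (event_support e)) es
    && timely rk levels' k.+1
  else true.

Lemma refutesP rk window_levels l s :
    timely rk window_levels (size l) -> refutes rk window_levels l ->
    size s = size window_levels -> all (fun a => a < 3) s ->
  has (fires (paint rk (l ++ s))) (flatten window_levels).
Proof.
elim: window_levels l s => //= es window_levels IH l [//|a s] /andP[es_t lv_t] r [sz].
move=> /= /andP[a3 s3]; rewrite has_cat.
have {r} /orP[r|r] : has (fires (paint rk (rcons l a))) es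
                   || refutes rk window_levels (rcons l a).
  by move: r; rewrite -!has_find; case: a a3 => [|[|[|]]] //= _ /and4P[].
- apply/orP; left; apply/hasP; case/hasP: r => e e_es e_fires.
  exists e => //; rewrite -(fires_local (c := paint rk (rcons l a))) // => x xe.
  rewrite /paint -cat_rcons nth_cat size_rcons ltnS.
  by rewrite (allP (allP es_t _ e_es) _ xe).
- by rewrite -cat_rcons IH ?size_rcons ?orbT.
Qed.

Definition window_levels : seq (seq event) :=
  let tagged := [seq (foldr maxn 0 (map (lookup window_ranks) (event_support e)), e) | e <- window_events] in
  [seq [seq te.2 | te <- tagged & te.1 == k] | k <- iota 2 23].

Lemma window_levels_refute : refutes window_ranks window_levels [:: 0; 0].
Proof. by vm_compute. Qed.

Lemma window_levels_timely : timely window_ranks window_levels 2.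
Proof. by vm_compute. Qed.

Lemma window_events_inside : all (fun e => all (mem window) (event_support e)) window_events.
Proof. by vm_compute. Qed.

Lemma lookupK : {in window, forall x, nth (0, 0) window (lookup window_ranks x) = x}.
Proof.
have : all (fun x => nth (0, 0) window (lookup window_ranks x) == x) window by [].
by move=> /allP rk x /rk/eqP.
Qed.

Lemma window_event (c : site -> nat) :
    (forall x, c x < 3) -> c (2, 2) = 0 -> c (2, 3) = 0 ->
  has (fires c) window_events.
Proof.
move=> c3 c0 c1; set s := [seq c x | x <- drop 2 window].
have sz_s : size s = size window_levels by rewrite !size_map size_iota size_drop.
have s3 : all (fun a => a < 3) s by rewrite all_map; apply/allP => x _ /=.
have := @refutesP window_ranks window_levels [:: 0;
  0] s window_levels_timely window_levels_refute sz_s s3.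
case/hasP=> e e_lv.
have {e_lv} e_ev : e \in window_events.
  case/flatten_mapP: e_lv => k _ /mapP[te]; rewrite mem_filter => /andP[_].
  by case/mapP => e' e'_ev -> ->.
have -> : [:: 0; 0] ++ s = map c window by rewrite /= c0 c1.
rewrite (fires_local (c' := c)); first by move=> ce; apply/hasP; exists e.
move=> x xe; have x_win := allP (allP window_events_inside _ e_ev) _ xe.
rewrite /paint (nth_map (0, 0)) ?lookupK //.
by have : all (fun x => lookup window_ranks x < size window) window by [];
  move/allP; apply.
Qed.

End Window.

Local Open Scope ring_scope.

(** * Recoloring a cycle *)

Lemma Z3_ind (P : 'Z_3 -> Prop) : P 0 -> P 1 -> P 2 -> forall a, P a.
Proof.
move=> P0 P1 P2; case=> [[|[|[|//]]] Hi].
- by rewrite (_ : Ordinal Hi = 0) //; apply: val_inj.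
- by rewrite (_ : Ordinal Hi = 1) //; apply: val_inj.
- by rewrite (_ : Ordinal Hi = 2) //; apply: val_inj.
Qed.

Lemma Zp_avoid (l : nat) (hl : (2 < l)%N) (a b : 'Z_l) : exists2 c, c != a & c != b.
Proof.
have : ~~ ([set: 'Z_l] \subset [set a; b]).
  apply/negP => /subset_leq_card; rewrite cardsT card_ord cards2.
  by have := Zp_cast (ltnW hl); case: (a != b) => /= lE; lia.
by case/subsetPn => c _; rewrite !inE negb_or => /andP[]; exists c.
Qed.

Section Cyclic.

Variables (m : nat) (hm : (2 < m)%N).

Let m1 : (1 < m)%N := ltnW hm.

Lemma natr_inj_near (i j : nat) :
  (i < j + 3)%N -> (j < i + 3)%N -> i%:R = j%:R :> 'Z_m -> i = j.
Proof.
wlog le_ij : i j / (i <= j)%N => [th ij ji e|].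
  by case: (leqP i j) => [|/ltnW] /th; [exact | move/(_ ji ij (esym e))].
move=> _ ji /(congr1 val); rewrite /= !val_Zp_nat // => /esym/eqP.
rewrite eqn_mod_dvd // => /dvdn_leq; lia.
Qed.

Lemma Zp1_neq0 : 1 != 0 :> 'Z_m.
Proof. by apply/eqP => /(@natr_inj_near 1 0 isT isT). Qed.

Lemma Zp2_neq0 : 1 + 1 != 0 :> 'Z_m.
Proof. by apply/eqP => /(@natr_inj_near 2 0 isT isT). Qed.

Lemma natr_modulus : m%:R = 0 :> 'Z_m.
Proof. by apply: val_inj; rewrite /= val_Zp_nat // modnn. Qed.

Lemma val_lt (i : 'Z_m) : (i < m)%N.
Proof. by have := ltn_ord i; rewrite [X in (_ < X)%N]Zp_cast. Qed.

Lemma val_natr (k : nat) : (k < m)%N -> (k%:R : 'Z_m) = k :> nat.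
Proof. by move=> km; rewrite val_Zp_nat // modn_small. Qed.

Lemma valS (i : 'Z_m) : i.+1 = m \/ (i + 1 : 'Z_m) = i.+1 :> nat.
Proof.
have := val_lt i; rewrite leq_eqVlt => /predU1P[|lt]; first by left.
by right; rewrite -{1}(natr_Zp i) natr1 val_natr.
Qed.

Lemma sum_cyclic (V : nmodType) (f : 'Z_m -> V) :
  \sum_(i : 'Z_m) f i = \sum_(i < m) f i%:R.
Proof.
rewrite -(big_mkord xpredT (fun i => f i%:R)) -[X in index_iota 0 X](Zp_cast m1).
by rewrite big_mkord; apply: eq_bigr => i _; rewrite natr_Zp.
Qed.

Section Recoloring.

Variables (T : Type) (w : 'Z_m -> 'Z_3) (g : {ffun 'Z_m -> 'Z_3} -> T).

Definition proper_coloring (x : {ffun 'Z_m -> 'Z_3}) :=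
  forall j, w j + x j - x (j + 1) != 0.

Let neqS (j : 'Z_m) : j + 1 != j.
Proof. by rewrite -subr_eq0 addrAC subrr add0r Zp1_neq0. Qed.

Let neqSS (j : 'Z_m) : j + 1 + 1 != j.
Proof. by rewrite -addrA -subr_eq0 addrAC subrr add0r Zp2_neq0. Qed.

Lemma recolor_forward (x : {ffun 'Z_m -> 'Z_3}) (j : 'Z_m) (t : 'Z_3) :
    proper_coloring x -> (w (j - 1) + x (j - 1) - t != 0) ->
  exists y, [/\ proper_coloring y, y j = t
              & forall i, i != j -> i != j + 1 -> y i = x i].
Proof.
move=> xP ht; have [s s1 s2] := Zp_avoid (isT : 2 < 3)%N (w j + t) (x (j + 1 + 1) - w (j + 1)).
exists [ffun i => if i == j then t else if i == j + 1 then s else x i].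
split=> [i||i /negPf ij /negPf ij1]; rewrite !ffunE ?eqxx ?ij ?ij1 //.
case: (eqVneq i j) => [->|ij].
  by rewrite (negPf (neqS j)) eqxx subr_eq0 eq_sym.
case: (eqVneq i (j + 1)) => [->|ij1].
  rewrite (negPf (neqSS j)) (negPf (neqS _)) subr_eq0 addrC.
  by apply: contra s2 => /eqP <-; rewrite addrK.
case: (eqVneq (i + 1) j) => [ij2|ij2]; first by rewrite -ij2 addrK in ht.
by rewrite (inj_eq (addIr 1)) (negPf ij); exact: xP.
Qed.

Lemma recolor_backward (x : {ffun 'Z_m -> 'Z_3}) (j : 'Z_m) (t : 'Z_3) :
    proper_coloring x -> (w j + t - x (j + 1) != 0) ->
  exists y, [/\ proper_coloring y, y j = t
              & forall i, i != j - 1 -> i != j -> y i = x i].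
Proof.
move=> xP ht.
have [s s1 s2] := Zp_avoid (isT : 2 < 3)%N (t - w (j - 1)) (w (j - 1 - 1) + x (j - 1 - 1)).
exists [ffun i => if i == j then t else if i == j - 1 then s else x i].
split=> [i||i /negPf ij /negPf ij1]; rewrite !ffunE ?eqxx ?ij ?ij1 //.
case: (eqVneq i j) => [->|ij].
  rewrite (negPf (neqS j)); case: (eqVneq (j + 1) (j - 1)) => // e.
  by have := neqSS j; rewrite e addrNK eqxx.
case: (eqVneq i (j - 1)) => [->|ij1].
  by rewrite subrK eqxx subr_eq0 addrC; apply: contra s1 => /eqP <-;
    rewrite addrK.
case: (eqVneq (i + 1) j) => [ij2|ij2].
  by rewrite -ij2 addrK eqxx in ij1.
case: (eqVneq (i + 1) (j - 1)) => [e|_]; last exact: xP.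
by rewrite -e addrK in s2; rewrite subr_eq0 eq_sym.
Qed.

Hypothesis g_local : forall (j : 'Z_m) x y, proper_coloring x -> proper_coloring y ->
  (forall i, i != j -> i != j + 1 -> x i = y i) -> g x = g y.

Lemma recolor_connected x y : proper_coloring x -> proper_coloring y -> g x = g y.
Proof.
move=> xP yP.
have agree k : (k < m.-1)%N -> forall z, proper_coloring z ->
    (forall i : 'Z_m, (i < m.-1 - k)%N -> z i = y i) -> g z = g y.
  elim: k => [|k IH] km z zP zy.
    apply: (g_local (j := m.-1%:R)) => // i im _; apply: zy.
    have := val_lt i; rewrite subn0 => i_lt;
      rewrite ltn_neqAle -ltnS prednK ?i_lt ?andbT; last lia.
    by apply: contra im => /eqP <-; rewrite natr_Zp.
  set j : 'Z_m := (m.-1 - k.+1)%:R.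
  have jE : j = (m.-1 - k.+1)%N :> nat by rewrite val_natr //; lia.
  have j0 : j != 0 by apply/eqP => e; move: jE; rewrite e /=; lia.
  have jB : (nat_of_ord (j - 1)%R < m.-1 - k.+1)%N.
    case: (valS (j - 1)) => [e|]; last by rewrite subrK; lia.
    case/eqP: j0; rewrite -[j](subrK 1) -[j - 1]natr_Zp natr1 e.
    exact: natr_modulus.
  have [|z' [z'P z'j z'z]] := recolor_forward (j := j) (t := y j) zP.
    by rewrite zy //; have := yP (j - 1); rewrite subrK.
  rewrite (g_local (j := j) zP z'P) => [|i ij ij1]; last by rewrite z'z.
  apply: IH => // [|i i_lt]; first lia.
  case: (eqVneq i j) => [->//|ij]; rewrite z'z // ?zy //.
    have : nat_of_ord i != j by apply: contra ij => /eqP/val_inj ->.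
    by rewrite jE; lia.
  apply/eqP => e; have := valS j; rewrite -e; move: ij (val_lt i) i_lt; lia.
have [t t1 t2] := Zp_avoid (isT : 2 < 3)%N (x 0 - w (-1)) (y 0 - w (-1)).
have [|x' [x'P x't x'x]] := recolor_backward (j := -1) (t := t) xP.
  by rewrite addNr subr_eq0; apply: contra t1 => /eqP <-;
    rewrite addrAC subrr add0r.
rewrite (g_local (j := -1 - 1) xP x'P) => [|i i1 i2]; last first.
  by rewrite subrK in i2; rewrite x'x.
have [|z [zP z0 zx]] := recolor_forward (j := 0) (t := y 0) x'P.
  by rewrite sub0r x't subr_eq0; apply: contra t2 => /eqP <-;
    rewrite addrAC subrr add0r.
rewrite (g_local (j := 0) x'P zP) => [|i i1 i2]; last by rewrite zx.
apply: (agree m.-2) => // [|i]; first lia.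
have -> : (m.-1 - m.-2 = 1)%N by lia.
by rewrite ltnS leqn0 => /eqP i0; rewrite (_ : i = 0) //; apply: val_inj.
Qed.

End Recoloring.

End Cyclic.

(** * Heights on the torus *)

Section Flows.

Variables (m n : nat) (hm : (2 < m)%N) (hn : (2 < n)%N).

Let m1 : (1 < m)%N := ltnW hm.
Let n1 : (1 < n)%N := ltnW hn.

Notation hex := ('Z_m * 'Z_n)%type.
Notation flow := {ffun hex -> 'Z_3}.

Implicit Types (u v : flow) (k : hex -> 'Z_3) (p q b : hex).

(* [u p] and [v p] are the values of the edges {p, p + a1} and {p, p + a2}; by
   the Gauss law at the A vertices {p + a1, p + a2} has value [- (u p + v p)],
   and [curl_free] is the Gauss law at the B vertices. *)
Definition curl_free u v := forall p, u (p + a2) + v (p + a1) = u p + v p.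

Definition allowed_flow u v :=
  [/\ curl_free u v, forall p, ~~ ((u p == 0) && (v p == 0))
    & forall p, ~~ ((v (p + a1) == 0) && (u (p + a2) == 0))].

Definition shift_h u k : flow := [ffun p => u p + (k (p + a1) - k p)].
Definition shift_v v k : flow := [ffun p => v p + (k p - k (p + a2))].

Lemma shift_hD u k k' : shift_h (shift_h u k) k' = shift_h u (k \+ k').
Proof. by apply/ffunP => p; rewrite !ffunE /=; ring. Qed.

Lemma shift_vD v k k' : shift_v (shift_v v k) k' = shift_v v (k \+ k').
Proof. by apply/ffunP => p; rewrite !ffunE /=; ring. Qed.

Lemma curl_free_shift u v k :
  curl_free u v -> curl_free (shift_h u k) (shift_v v k).
Proof.
move=> uv p; rewrite !ffunE [p + a2 + a1]addrAC.
have -> : u (p + a2) = u p + v p - v (p + a1) by rewrite -uv addrK.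
ring.
Qed.

Definition holonomy_h u := \sum_(i : 'Z_m) u (i, 0).
Definition holonomy_v v := \sum_(j : 'Z_n) v (0, j).

Lemma hexD (i i' : 'Z_m) (j j' : 'Z_n) : (i, j) + (i', j') = (i + i', j + j').
Proof. by []. Qed.

Lemma holonomy_h_shift u k : holonomy_h (shift_h u k) = holonomy_h u.
Proof.
rewrite /holonomy_h; under eq_bigr do rewrite ffunE.
rewrite big_split /= -[RHS]addr0; congr (_ + _); rewrite sumrB.
rewrite [X in _ - X](reindex_inj (addIr 1)) /=; apply/eqP; rewrite subr_eq0.
by apply/eqP/eq_bigr => i _; rewrite /a1 hexD addr0.
Qed.

Lemma holonomy_v_shift v k : holonomy_v (shift_v v k) = holonomy_v v.
Proof.
rewrite /holonomy_v; under eq_bigr do rewrite ffunE.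
rewrite big_split /= -[RHS]addr0; congr (_ + _); rewrite sumrB.
rewrite [X in X - _](reindex_inj (addIr 1)) /=; apply/eqP; rewrite subr_eq0.
by apply/eqP/eq_bigr => j _; rewrite /a2 hexD addr0.
Qed.

Lemma holonomy_h_row u v j :
  curl_free u v -> \sum_(i : 'Z_m) u (i, j) = holonomy_h u.
Proof.
move=> uv; rewrite -(natr_Zp j); elim: (val j) => [|l IH] //.
rewrite -{}IH -natr1; have := uv (_, l%:R); rewrite /a1 /a2 => uvl.
have {uvl} uvl i : u (i, l%:R + 1) = u (i, l%:R) + (v (i, l%:R) - v (i + 1, l%:R)).
  by have := uvl i; rewrite !hexD !addr0 => e; rewrite addrA -e addrK.
under eq_bigr do rewrite uvl.
rewrite big_split /= -[RHS]addr0; congr (_ + _); rewrite sumrB.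
by rewrite [X in X - _](reindex_inj (addIr 1)) /= subrr.
Qed.

Lemma holonomy_v_column u v i :
  curl_free u v -> \sum_(j : 'Z_n) v (i, j) = holonomy_v v.
Proof.
move=> uv; rewrite -(natr_Zp i); elim: (val i) => [|l IH] //.
rewrite -{}IH -natr1; have := uv (l%:R, _); rewrite /a1 /a2 => uvl.
have {uvl} uvl j : v (l%:R + 1, j) = v (l%:R, j) + (u (l%:R, j) - u (l%:R, j + 1)).
  have := uvl j; rewrite !hexD !addr0 => e.
  by rewrite addrA [v _ + _]addrC -e [u _ + _]addrC addrK.
under eq_bigr do rewrite uvl.
rewrite big_split /= -[RHS]addr0; congr (_ + _); rewrite sumrB.
by rewrite [X in X - _](reindex_inj (addIr 1)) /= subrr.
Qed.

Definition offset b (x : site) : hex := b + (x.1%:R, x.2%:R).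

Lemma offset_a1 b i j : offset b (i.+1, j) = offset b (i, j) + a1.
Proof. by rewrite /offset /a1 -addrA hexD addr0 natr1. Qed.

Lemma offset_a2 b i j : offset b (i, j.+1) = offset b (i, j) + a2.
Proof. by rewrite /offset /a2 -addrA hexD addr0 natr1. Qed.

Definition height u v b (x : site) : 'Z_3 :=
  \sum_(i < x.1) u (offset b (nat_of_ord i, 0%N))
  - \sum_(j < x.2) v (offset b (x.1, nat_of_ord j)).

Lemma height_v u v b i j :
  height u v b (i, j) - height u v b (i, j.+1) = v (offset b (i, j)).
Proof. by rewrite /height /= big_ord_recr /=; ring. Qed.

Lemma height_h u v b i j : curl_free u v ->
  height u v b (i.+1, j) - height u v b (i, j) = u (offset b (i, j)).
Proof.
move=> uv; elim: j => [|j IH].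
  by rewrite /height /= big_ord_recr !big_ord0 /=; ring.
have := uv (offset b (i, j));
  rewrite -offset_a1 -offset_a2 -IH -!(height_v u) => e.
by apply: (addIr (height u v b (i.+1, j) - height u v b (i.+1, j.+1)));
  rewrite e; ring.
Qed.

Lemma potential u v u' v' :
    curl_free u v -> curl_free u' v' ->
    holonomy_h u = holonomy_h u' -> holonomy_v v = holonomy_v v' ->
  exists k, u' = shift_h u k /\ v' = shift_v v k.
Proof.
move=> uv uv' uh vh.
pose du := [ffun p => u' p - u p]; pose dv := [ffun p => v' p - v p].
have duv : curl_free du dv.
  move=> p; rewrite !ffunE.
  have -> : u (p + a2) = u p + v p - v (p + a1) by rewrite -uv addrK.
  have -> : u' (p + a2) = u' p + v' p - v' (p + a1) by rewrite -uv' addrK.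
  ring.
have duh : holonomy_h du = 0.
  by rewrite /holonomy_h; under eq_bigr do rewrite ffunE; rewrite sumrB;
    apply/eqP; rewrite subr_eq0; apply/eqP.
have dvh : holonomy_v dv = 0.
  by rewrite /holonomy_v; under eq_bigr do rewrite ffunE; rewrite sumrB;
    apply/eqP; rewrite subr_eq0; apply/eqP.
pose H := height du dv 0.
have offE (i j : nat) : offset 0 (i, j) = (i%:R, j%:R) :> hex by rewrite /offset add0r.
have Hm j : H (m, j) = H (0, j)%N.
  elim: j => [|j IH].
    rewrite /H /height /= !big_ord0 !subr0 -[RHS]duh /holonomy_h (sum_cyclic hm).
    by apply: eq_bigr => i _; rewrite offE.
  have := height_v du dv 0 m j; have := height_v du dv 0 0 j.
  rewrite !offE natr_modulus // -/H IH => <-.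
  by move/addrI/oppr_inj.
have Hn i : H (i, n) = H (i, 0)%N.
  elim: i => [|i IH].
    rewrite /H /height /= !big_ord0; congr (_ - _).
    rewrite -[RHS]dvh /holonomy_v (sum_cyclic hn).
    by apply: eq_bigr => j _; rewrite offE.
  have := height_h 0 i n duv; have := height_h 0 i 0 duv.
  rewrite !offE natr_modulus // -/H IH => <-.
  exact: addIr.
pose k p := H (nat_of_ord p.1, nat_of_ord p.2).
exists k; split; apply/ffunP => -[i j]; rewrite ffunE.
- have -> : k ((i, j) + a1) = H (i.+1, nat_of_ord j).
    rewrite /k /a1 hexD addr0 /=; case: (valS hm i) => [e|<-//].
    have x0 : i + 1 = 0 by rewrite -(natr_Zp i) natr1 e natr_modulus.
    by rewrite e Hm; congr (H (_, _)); exact: (congr1 val x0).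
  rewrite /k /H height_h // offE !natr_Zp ffunE; ring.
- have -> : k ((i, j) + a2) = H (nat_of_ord i, j.+1).
    rewrite /k /a2 hexD addr0 /=; case: (valS hn j) => [e|<-//].
    have x0 : j + 1 = 0 by rewrite -(natr_Zp j) natr1 e natr_modulus.
    by rewrite e Hn; congr (H (_, _)); exact: (congr1 val x0).
  rewrite /k /H height_v offE !natr_Zp ffunE; ring.
Qed.

End Flows.

Section Connectivity.

Variables (m n : nat) (hm : (2 < m)%N) (hn : (2 < n)%N).

Notation hex := ('Z_m * 'Z_n)%type.
Notation flow := {ffun hex -> 'Z_3}.

Implicit Types (u v : flow) (k : hex -> 'Z_3) (p q b : hex).

Lemma allowed_flow_straight u v :
  curl_free u v -> (forall p, v p != 0) -> allowed_flow u v.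
Proof.
by move=> uv v0; split=> // p; rewrite negb_and ?v0 // orbT.
Qed.

Definition vertical_zeros v := count (fun p => v p == 0) (enum {: hex}).

Definition near_site (x y : site) :=
  [&& x.1 < y.1 + 3, y.1 < x.1 + 3, x.2 < y.2 + 3 & y.2 < x.2 + 3]%N.

Lemma window_pairs_near : all (fun PQ : site * site =>
    all (fun x => near_site x PQ.1 && near_site x PQ.2) (event_support (inr (PQ, (0, 0))%N)))
  window_pairs.
Proof. by vm_compute. Qed.

Lemma basesV_near : all (fun PQ : site * site =>
    all (fun x => all (near_site x) (bases2 basesV PQ.1 PQ.2)) (bases2 basesV PQ.1 PQ.2))
  window_pairs.
Proof. by vm_compute. Qed.

Lemma window_pairs_pos : all (fun PQ : site * site =>
    [&& 0 < PQ.1.1, 0 < PQ.1.2, 0 < PQ.2.1 & 0 < PQ.2.2]%N) window_pairs.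
Proof. by vm_compute. Qed.

Lemma window_pairs_adjacent b (PQ : site * site) :
  PQ \in window_pairs -> adjacent (offset b PQ.1) (offset b PQ.2).
Proof.
have : all (fun PQ : site * site =>
  [|| PQ.2 == (PQ.1.1.+1, PQ.1.2), PQ.2 == (PQ.1.1, PQ.1.2.+1)
    | (PQ.2.1.+1, PQ.2.2) == (PQ.1.1, PQ.1.2.+1)]) window_pairs by vm_compute.
move=> /allP sh /sh {sh}; case: PQ => [[i j] Q] /=.
case/or3P => /eqP; rewrite /adjacent.
- by move=> ->; rewrite offset_a1 addrAC subrr add0r mem_head.
- by move=> ->; rewrite offset_a2 addrAC subrr add0r !inE eqxx !orbT.
- move=> e; have : offset b (Q.1.+1, Q.2) = offset b (i, j.+1) by rewrite e.
  rewrite offset_a1 offset_a2; case: Q {e} => [i' j'] /= e.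
  have -> : offset b (i', j') - offset b (i, j) = - (a1 - a2).
    by apply: (addIr a1); rewrite addrAC e opprB subrK addrAC subrr add0r.
  by rewrite !inE eqxx !orbT.
Qed.

Lemma offset_near b (x y : site) :
  near_site x y -> (offset b x == offset b y) = (x == y).
Proof.
case: x y => [i j] [i' j'] /and4P[/= h1 h2 h3 h4].
rewrite /offset (inj_eq (addrI b)) /= !xpair_eqE.
apply/andP/andP => -[/eqP ei /eqP ej]; last by rewrite ei ej.
by rewrite (natr_inj_near hm h1 h2 ei) (natr_inj_near hn h3 h4 ej).
Qed.

Lemma count_lt_local (T : finType) (r r' : pred T) (s : seq T) :
    uniq s -> (forall x, x \notin s -> r x = r' x) -> (count r s < count r' s)%N ->
  (count r (enum T) < count r' (enum T))%N.
Proof.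
move=> s_uniq rr' lt_s.
have pe : perm_eq (enum T) (s ++ [seq x <- enum T | x \notin s]).
  apply: uniq_perm; first exact: enum_uniq.
    rewrite cat_uniq s_uniq filter_uniq ?enum_uniq // andbT.
    by apply/hasPn => x; rewrite mem_filter => /andP[].
  by move=> x; rewrite mem_cat mem_filter mem_enum inE andbT orbN.
rewrite !(permP pe) !count_cat;
  rewrite (eq_in_count (a2 := r') (s := filter _ _)).
  by rewrite ltn_add2r.
by move=> x; rewrite mem_filter => /andP[/rr'].
Qed.

Lemma Z3_val_eq (a b : 'Z_3) : (nat_of_ord a == nat_of_ord b) = (a - b == 0).
Proof. by rewrite subr_eq0. Qed.

Lemma improving_move u v p0 : allowed_flow u v -> v p0 = 0 ->
  exists P Q k, [/\ adjacent P Q, forall p, p != P -> p != Q -> k p = 0,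
    allowed_flow (shift_h u k) (shift_v v k) & (vertical_zeros (shift_v v k) < vertical_zeros v)%N].
Proof.
move=> [uv uvA uvB] vp0; pose b := p0 - (2, 2).
have p0E : offset b (2, 2)%N = p0 by rewrite /offset subrK.
pose H x := height u v b x - height u v b (2, 2)%N.
have HV i j : H (i, j) - H (i, j.+1) = v (offset b (i, j)).
  by rewrite -(height_v u) /H; ring.
have HU i j : H (i.+1, j) - H (i, j) = u (offset b (i, j)).
  by rewrite -(height_h b i j uv) /H; ring.
have H22 : H (2, 2)%N = 0 by rewrite /H subrr.
have H23 : H (2, 3)%N = 0.
  by have := HV 2%N 2%N; rewrite p0E vp0 H22 sub0r => /eqP;
    rewrite oppr_eq0 => /eqP.
pose c x := nat_of_ord (H x).
have c3 x : (c x < 3)%N by exact: ltn_ord.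
have /hasP[[[x|x]|[[P Q] [a a']]] e_ev] :=
  window_event c3 (congr1 val H22) (congr1 val H23).
- case: x e_ev => i j _ /andP[]; rewrite !Z3_val_eq => /eqP e1 /eqP e2.
  have := uvA (offset b (i, j)); rewrite -HU -HV e2 eqxx andbT.
  by rewrite -opprB e1 oppr0 eqxx.
- case: x e_ev => i j _ /andP[]; rewrite !Z3_val_eq => /eqP e1 /eqP e2.
  have := uvB (offset b (i, j)); rewrite -offset_a1 -offset_a2 -HU -HV.
  have -> : H (i.+1, j) - H (i.+1, j.+1) = 0 by rewrite -[RHS]addr0 -{1}e1 -{1}e2; ring.
  by rewrite -opprB e2 oppr0 eqxx.
have [PQ_pairs a3 a'3] := mem_window_events_improve e_ev.
have PQ_near := allP (allP window_pairs_near _ PQ_pairs).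
have /and4P[P1 P2 Q1 Q2] := allP window_pairs_pos _ PQ_pairs.
have adjPQ := window_pairs_adjacent b PQ_pairs.
rewrite /= in adjPQ P1 P2 Q1 Q2.
move=> /and3P[impA impB impV].
pose k q := if q == offset b P then a%:R - H P
            else if q == offset b Q then a'%:R - H Q else 0.
pose r := recolor c P Q a a'.
have rE x : x \in event_support (inr (P, Q, (0, 0))%N) -> nat_of_ord (H x + k (offset b x)) = r x.
  move=> /PQ_near/andP[xP xQ].
  rewrite /k /r /recolor !offset_near //; case: (eqVneq x P) => [->|_].
    by rewrite addrC subrK /= val_Zp_nat // modn_small.
  case: (eqVneq x Q) => [->|_].
    by rewrite addrC subrK /= val_Zp_nat // modn_small.
  by rewrite addr0.
set u' := shift_h u k; set v' := shift_v v k.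
pose H' x := H x + k (offset b x).
have HV' i j : H' (i, j) - H' (i, j.+1) = v' (offset b (i, j)).
  by rewrite ffunE /H' offset_a2 -HV; ring.
have HU' i j : H' (i.+1, j) - H' (i, j) = u' (offset b (i, j)).
  by rewrite ffunE /H' offset_a1 -HU; ring.
have k_supp q : k q != 0 -> q = offset b P \/ q = offset b Q.
  rewrite /k; case: (eqVneq q (offset b P)) => [|_]; first by left.
  by case: (eqVneq q (offset b Q)) => [|_]; [right | rewrite eqxx].
have corner q d (f : site -> site) (B : site -> seq site) :
    f P \in B P -> f Q \in B Q ->
    offset b (f P) + d = offset b P -> offset b (f Q) + d = offset b Q ->
    q \notin map (offset b) (bases2 B P Q) -> k (q + d) = 0.
  move=> fP fQ eP eQ; apply: contraNeq => /k_supp[];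
    rewrite -?eP -?eQ => /addIr ->;
  by apply/map_f; rewrite mem_undup mem_cat ?fP ?fQ ?orbT.
have offset_pred1 x : (0 < x.1)%N -> offset b (x.1.-1, x.2) + a1 = offset b x.
  by case: x => [i j] /= i0; rewrite -offset_a1 prednK.
have offset_pred2 x : (0 < x.2)%N -> offset b (x.1, x.2.-1) + a2 = offset b x.
  by case: x => [i j] /= j0; rewrite -offset_a2 prednK.
have offset_pred12 x : (0 < x.1)%N -> (0 < x.2)%N ->
    offset b (x.1.-1, x.2.-1) + (a1 + a2) = offset b x.
  by case: x => [i j] /= i0 j0; rewrite addrA -offset_a1 -offset_a2 !prednK.
have k0A q : q \notin map (offset b) (bases2 basesA P Q) ->
    [/\ k q = 0, k (q + a1) = 0 & k (q + a2) = 0].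
  move=> qn; split.
  - by rewrite -[q]addr0; apply: (corner _ _ id) qn; rewrite ?mem_head ?addr0.
  - apply: (corner _ _ (fun x => (x.1.-1, x.2))) qn;
    by rewrite ?offset_pred1 ?inE ?eqxx ?orbT.
  - apply: (corner _ _ (fun x => (x.1, x.2.-1))) qn;
    by rewrite ?offset_pred2 ?inE ?eqxx ?orbT.
have k0B q : q \notin map (offset b) (bases2 basesB P Q) ->
    [/\ k (q + a1) = 0, k (q + a2) = 0 & k (q + (a1 + a2)) = 0].
  move=> qn; split.
  - apply: (corner _ _ (fun x => (x.1.-1, x.2))) qn;
    by rewrite ?offset_pred1 ?inE ?eqxx ?orbT.
  - apply: (corner _ _ (fun x => (x.1, x.2.-1))) qn;
    by rewrite ?offset_pred2 ?inE ?eqxx ?orbT.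
  - apply: (corner _ _ (fun x => (x.1.-1, x.2.-1))) qn;
    by rewrite ?offset_pred12 ?inE ?eqxx ?orbT.
have k0V q : q \notin map (offset b) (bases2 basesV P Q) -> k q = 0 /\ k (q + a2) = 0.
  move=> qn; split.
  - by rewrite -[q]addr0; apply: (corner _ _ id) qn; rewrite ?mem_head ?addr0.
  - apply: (corner _ _ (fun x => (x.1, x.2.-1))) qn;
    by rewrite ?offset_pred2 ?inE ?eqxx ?orbT.
have uv' : curl_free u' v' by exact: curl_free_shift.
exists (offset b P), (offset b Q), k; split=> //.
- by move=> q qP qQ; apply: contraNeq qP => /k_supp[-> //|qE];
    rewrite qE eqxx in qQ.
- split=> // q.
  + have [/mapP[[i j] x_in ->]|/k0A[k1 k2 k3]] := boolP (q \in map (offset b) (bases2 basesA P Q)); last first.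
      by rewrite /u' /v' !ffunE k1 k2 k3 !subr0 !addr0.
    rewrite -HU' -HV' -opprB oppr_eq0 -!Z3_val_eq !rE;
      try by rewrite mem_cat; apply/orP; left; apply/flatten_mapP;
        exists (i, j); rewrite ?inE ?eqxx ?orbT.
    exact: (allP impA).
  + have [/mapP[[i j] x_in ->]|/k0B[k1 k2 k3]] := boolP (q \in map (offset b) (bases2 basesB P Q)); last first.
      rewrite /u' /v' !ffunE -!addrA [a2 + a1]addrC k1 k2 k3 !subr0 !addr0.
      exact: uvB.
    rewrite -offset_a1 -offset_a2 -HU' -HV' [_ - _ == 0 in X in _ && X]subr_eq0 [X in _ && X]eq_sym -subr_eq0 -!Z3_val_eq !rE;
      try by rewrite !mem_cat; apply/orP; right; apply/orP; left;
        apply/flatten_mapP; exists (i, j); rewrite ?inE ?eqxx ?orbT.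
    have := allP impB _ x_in; apply: contra => /andP[/eqP e1 /eqP e2].
    by apply/andP; split; apply/eqP; rewrite /= -/r; congruence.
- apply: (@count_lt_local _ _ _ (map (offset b) (bases2 basesV P Q))).
  + rewrite map_inj_in_uniq ?undup_uniq // => x y x_in y_in /eqP.
    rewrite offset_near => [/eqP //|].
    exact: (allP (allP (allP basesV_near _ PQ_pairs) _ x_in)).
  + by move=> q /k0V[k1 k2] /=; rewrite /v' ffunE k1 k2 subrr addr0.
  + rewrite !count_map; move: impV; congr (_ < _)%N;
      apply: eq_in_count => -[i j] x_in /=.
    * rewrite /flatV -/r -!rE ?Z3_val_eq -?HV' //;
      by rewrite !mem_cat; apply/orP; right; apply/orP; right;
        apply/flatten_mapP; exists (i, j); rewrite ?inE ?eqxx ?orbT.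
    * by rewrite /flatV Z3_val_eq HV.
Qed.

Section Invariant.

Variables (T : Type) (F : flow -> flow -> T).

Hypothesis F_move : forall u v k P Q, adjacent P Q ->
  allowed_flow u v -> allowed_flow (shift_h u k) (shift_v v k) ->
  (forall p, p != P -> p != Q -> k p = 0) ->
  F u v = F (shift_h u k) (shift_v v k).

Lemma invariant_straighten u v : allowed_flow u v ->
  exists u' v', [/\ allowed_flow u' v', forall p, v' p != 0,
    holonomy_h u' = holonomy_h u, holonomy_v v' = holonomy_v v & F u v = F u' v'].
Proof.
have [z] := ubnP (vertical_zeros v); elim: z u v => // z IH u v lt_z uv.
have [/existsP[p /eqP vp]|nz] := boolP [exists p, v p == 0]; last first.
  by exists u, v; split=> // p; move: nz; rewrite negb_exists => /forallP.
have [P [Q [k [PQ k0 uv' lt_v]]]] := improving_move uv vp.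
have [|u' [v' [uv'' nz hh hv FE]]] := IH _ _ _ uv';
  first exact: leq_trans lt_v _.
exists u', v'; split=> //; first by rewrite hh holonomy_h_shift.
  by rewrite hv holonomy_v_shift.
by rewrite -FE; exact: F_move PQ _ _ _.
Qed.

Lemma invariant_straight u v k :
    curl_free u v -> (forall p, v p != 0) -> (forall p, shift_v v k p != 0) ->
  F u v = F (shift_h u k) (shift_v v k).
Proof.
move=> uv v0 v0'.
pose G k' := F (shift_h u k') (shift_v v k').
have G_move k1 k2 P Q : adjacent P Q ->
    (forall p, shift_v v k1 p != 0) -> (forall p, shift_v v k2 p != 0) ->
    (forall p, p != P -> p != Q -> k1 p = k2 p) -> G k1 = G k2.
  move=> PQ nz1 nz2 k12; pose k' p := k2 p - k1 p.
  have kE p : k1 p + k' p = k2 p by rewrite addrC subrK.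
  have hE : shift_h (shift_h u k1) k' = shift_h u k2.
    by rewrite shift_hD; apply/ffunP => p; rewrite !ffunE /= !kE.
  have vE : shift_v (shift_v v k1) k' = shift_v v k2.
    by rewrite shift_vD; apply/ffunP => p; rewrite !ffunE /= !kE.
  rewrite /G -hE -vE; apply: (F_move PQ).
  - by apply: allowed_flow_straight => //; exact: curl_free_shift.
  - rewrite hE vE.
    by apply: allowed_flow_straight => //; exact: curl_free_shift.
  - by move=> p pP pQ; rewrite /k' (k12 _ pP pQ) subrr.
have G_ext k1 k2 : k1 =1 k2 -> G k1 = G k2.
  by move=> k12; rewrite /G; congr (F _ _); apply/ffunP => p;
    rewrite !ffunE !k12.
pose cut c p := if (nat_of_ord p.1 < c)%N then k p else 0.
have step c : (c < m)%N -> G (cut c) = G (cut c.+1).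
  move=> cm; pose i : 'Z_m := c%:R.
  have iE : nat_of_ord i = c by rewrite val_natr.
  pose fill (x : {ffun 'Z_n -> 'Z_3}) p := if p.1 == i then x p.2 else cut c p.
  pose w (j : 'Z_n) := v (i, j).
  have cut_nz x : proper_coloring w x -> forall p, shift_v v (fill x) p != 0.
    move=> xP [i' j]; rewrite ffunE /a2 hexD addr0 /fill /=;
      case: (eqVneq i' i) => [->|_].
      by have := xP j; rewrite -addrA.
    rewrite /cut /=; case: ltnP => _; last by rewrite subrr addr0.
    by have := v0' (i', j); rewrite ffunE /a2 hexD addr0.
  have cutE : cut c =1 fill [ffun _ => 0].
    move=> p; rewrite /fill ffunE; case: eqP => // e.
    by rewrite /cut e iE ltnn.
  have cutE' : cut c.+1 =1 fill [ffun j => k (i, j)].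
    move=> [i' j]; rewrite /fill ffunE /cut /=; case: (eqVneq i' i) => [->|ii].
      by rewrite iE ltnSn.
    have : nat_of_ord i' != c by apply: contra ii => /eqP e; apply/eqP/val_inj;
      rewrite /= iE.
    by rewrite ltnS leq_eqVlt => /negPf ->.
  rewrite (G_ext _ _ cutE) (G_ext _ _ cutE').
  apply: (@recolor_connected n hn _ w (fun x => G (fill x))) => [j x y xP yP xy|j|j].
  - apply: (G_move _ _ (i, j) (i, j + 1)).
    + by rewrite /adjacent (_ : _ - _ = a2) ?inE ?eqxx ?orbT //; apply/eqP;
        rewrite subr_eq /a2 hexD add0r [1 + j]addrC.
    + exact: cut_nz.
    + exact: cut_nz.
    + move=> [i' j'] n1 n2; rewrite /fill /=; case: eqP => // e; apply: xy.
        by apply: contra n1 => /eqP ->; rewrite e.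
      by apply: contra n2 => /eqP ->; rewrite e.
  - by rewrite !ffunE subr0 addr0 v0.
  - by have := v0' (i, j); rewrite !ffunE /a2 hexD addr0 -addrA.
have all_steps c : (c <= m)%N -> G (cut 0%N) = G (cut c).
  elim: c => [_|c IH cm]; first by [].
  by rewrite (IH (ltnW cm)); exact: step.
rewrite -[RHS]/(G k); have <- : G (cut m) = G k by apply: G_ext => p;
  rewrite /cut (val_lt hm).
rewrite -(all_steps m (leqnn m)) /G; congr (F _ _); apply/ffunP => p;
by rewrite ffunE /cut !ltn0 subr0 addr0.
Qed.

Theorem invariant_connected u v u' v' :
    allowed_flow u v -> allowed_flow u' v' ->
    holonomy_h u = holonomy_h u' -> holonomy_v v = holonomy_v v' ->
  F u v = F u' v'.
Proof.
move=> /invariant_straighten[u1 [v1 [uv1 nz1 hh1 hv1 ->]]].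
move=> /invariant_straighten[u2 [v2 [uv2 nz2 hh2 hv2 ->]]] hh hv.
have [c1 _ _] := uv1; have [c2 _ _] := uv2.
have [||k [uE vE]] := potential hm hn c1 c2; rewrite ?hh1 ?hv1 ?hh2 ?hv2 //.
by rewrite uE vE; apply: invariant_straight => // p; rewrite -vE.
Qed.

End Invariant.

End Connectivity.

(** * Edges and vertices of the honeycomb lattice *)

Lemma eq_set2 (T : finType) (a b c d : T) :
  [set a; b] = [set c; d] -> (a = c /\ b = d) \/ (a = d /\ b = c).
Proof.
move=> e.
have /set2P ha : a \in [set c; d] by rewrite -e set21.
have /set2P hb : b \in [set c; d] by rewrite -e set22.
have /set2P hc : c \in [set a; b] by rewrite e set21.
have /set2P hd : d \in [set a; b] by rewrite e set22.
by case: ha hb hc hd => -> [] -> [] ? [] ?; auto.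
Qed.

Lemma big_set3 (V : nmodType) (T : finType) (f : T -> V) (a b c : T) :
  a != b -> a != c -> b != c ->
  \sum_(x in [set a; b; c]) f x = f a + f b + f c.
Proof.
move=> ab ac bc; rewrite setUC big_setU1 ?inE ?(eq_sym c) ?negb_or ?ac //=.
by rewrite big_setU1 ?inE //= big_set1 addrC.
Qed.

Lemma forall_set3 (T : finType) (P : pred T) (a b c : T) :
  [forall x in [set a; b; c], P x] = [&& P a, P b & P c].
Proof.
apply/forall_inP/and3P => [Pabc|[Pa Pb Pc] x].
  by split; apply: Pabc; rewrite !inE eqxx ?orbT.
by rewrite !inE => /orP[/orP[]|] /eqP ->.
Qed.

Section Edges.

Variables (m n : nat) (hm : (2 < m)%N) (hn : (2 < n)%N).

Notation hex := ('Z_m * 'Z_n)%type.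
Notation flow := {ffun hex -> 'Z_3}.

Implicit Types (u v : flow) (p q P Q : hex) (L : config m n) (e : edge m n).

Lemma hexN (i : 'Z_m) (j : 'Z_n) : - (i, j) = (- i, - j).
Proof. by []. Qed.

Lemma adjacentE p q : adjacent p q =
  (q - p \in [:: (1, 0); (-1, 0); (0, 1); (0, -1); (1, -1); (-1, 1)]).
Proof.
by rewrite /adjacent /a1 /a2 !hexN !hexD /= !sub0r !subr0 ?addr0 ?add0r !oppr0 !opprK.
Qed.

Lemma adjacent_neq p q : adjacent p q -> p != q.
Proof.
have [z1 z2] := (Zp1_neq0 hm, Zp1_neq0 hn).
apply: contraTneq => ->; rewrite adjacentE subrr -[0]/(0, 0) !inE !xpair_eqE.
by rewrite !(eq_sym 0) !oppr_eq0 ?(negPf z1) ?(negPf z2) ?andbF.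
Qed.

Lemma is_edge_adjacent p q : adjacent p q -> is_edge [set p; q].
Proof. by move=> pq; apply/existsP; exists p; apply/existsP; exists q;
  rewrite pq /=. Qed.

Lemma adjacent_h p : adjacent p (p + a1).
Proof. by rewrite /adjacent addrC addKr mem_head. Qed.

Lemma adjacent_v p : adjacent p (p + a2).
Proof. by rewrite /adjacent addrC addKr !inE eqxx !orbT. Qed.

Lemma adjacent_d p : adjacent (p + a1) (p + a2).
Proof.
rewrite /adjacent (_ : _ - _ = - (a1 - a2)) ?inE ?eqxx ?orbT //; ring.
Qed.

Definition hedge p : edge m n := exist _ [set p;
  p + a1] (is_edge_adjacent (adjacent_h p)).
Definition vedge p : edge m n := exist _ [set p;
  p + a2] (is_edge_adjacent (adjacent_v p)).
Definition dedge p : edge m n :=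
  exist _ [set p + a1; p + a2] (is_edge_adjacent (adjacent_d p)).

Lemma edge_ends e : exists p q, adjacent p q /\ val e = [set p; q].
Proof.
by case/existsP: (valP e) => p /existsP[q /andP[pq /eqP ->]]; exists p, q.
Qed.

Lemma edge_cases (C : edge m n -> Prop) :
    (forall p, C (hedge p)) -> (forall p, C (vedge p)) -> (forall p, C (dedge p)) ->
  forall e, C e.
Proof.
move=> Ch Cv Cd e; have [p [q [pq eE]]] := edge_ends e.
move: pq; rewrite /adjacent !inE !subr_eq => /or4P[|||/or3P[]] /eqP qE.
- suff -> : e = hedge p by [].
  by apply: val_inj; rewrite eE qE addrC.
- suff -> : e = hedge q by [].
  by apply: val_inj; rewrite eE qE /= [_ + p + a1]addrAC addNr add0r setUC.
- suff -> : e = vedge p by [].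
  by apply: val_inj; rewrite eE qE addrC.
- suff -> : e = vedge q by [].
  by apply: val_inj; rewrite eE qE /= [_ + p + a2]addrAC addNr add0r setUC.
- suff -> : e = dedge (p - a2) by [].
  by apply: val_inj; rewrite eE qE /= subrK setUC; congr [set _; _]; ring.
- suff -> : e = dedge (q - a2) by [].
  by apply: val_inj; rewrite eE qE /= subrK; congr [set _; _]; ring.
Qed.

Lemma hex_neq0 (i : 'Z_m) (j : 'Z_n) : (i != 0) || (j != 0) -> (i, j) != 0 :> hex.
Proof. by rewrite -negb_and -xpair_eqE. Qed.

Lemma hedge_inj : injective hedge.
Proof.
move=> p q /(congr1 val)/eq_set2[[]//|[-> e]].
have /eqP[] : a1 + a1 != 0 :> hex by rewrite hex_neq0 //= Zp2_neq0.
by rewrite [LHS](_ : _ = q + a1 + a1 - q); [rewrite e subrr | ring].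
Qed.

Lemma vedge_inj : injective vedge.
Proof.
move=> p q /(congr1 val)/eq_set2[[]//|[-> e]].
have /eqP[] : a2 + a2 != 0 :> hex by rewrite hex_neq0 //= Zp2_neq0 ?orbT.
by rewrite [LHS](_ : _ = q + a2 + a2 - q); [rewrite e subrr | ring].
Qed.

Lemma dedge_inj : injective dedge.
Proof.
move=> p q /(congr1 val)/eq_set2[[/addIr]//|[e1 e2]].
have /eqP[] : (a2 - a1) + (a2 - a1) != 0 :> hex.
  by rewrite hex_neq0 //= oppr0 addr0 Zp2_neq0 ?orbT.
rewrite [LHS](_ : _ = (q + a2 - (p + a1)) + (p + a2 - (q + a1))); last by ring.
by rewrite e1 e2 !subrr addr0.
Qed.

Lemma vedge_neq_hedge p q : vedge p != hedge q.
Proof.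
apply/eqP => /(congr1 val)/eq_set2[[-> e]|[-> e]].
  have /eqP[] : a2 - a1 != 0 :> hex.
    by rewrite hex_neq0 //= oppr0 addr0 Zp1_neq0 ?orbT.
  by rewrite [LHS](_ : _ = q + a2 - (q + a1)); [rewrite e subrr | ring].
have /eqP[] : a1 + a2 != 0 :> hex by rewrite hex_neq0 //= addr0 Zp1_neq0.
by rewrite [LHS](_ : _ = q + a1 + a2 - q); [rewrite e subrr | ring].
Qed.

Lemma dedge_neq_hedge p q : dedge p != hedge q.
Proof.
apply/eqP => /(congr1 val)/eq_set2[[e1 e2]|[e1 e2]].
  have /eqP[] : a2 - a1 - a1 != 0 :> hex.
    by rewrite hex_neq0 //= oppr0 !addr0 Zp1_neq0 ?orbT.
  rewrite [LHS](_ : _ = (p + a2 - (q + a1)) - (p + a1 - q)); last by ring.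
  by rewrite e1 e2 !subrr.
have /eqP[] : a2 != 0 :> hex by rewrite hex_neq0 //= Zp1_neq0 ?orbT.
rewrite [LHS](_ : _ = (p + a2 - q) - (p + a1 - (q + a1))); last by ring.
by rewrite e1 e2 !subrr.
Qed.

Lemma dedge_neq_vedge p q : dedge p != vedge q.
Proof.
apply/eqP => /(congr1 val)/eq_set2[[e1 e2]|[e1 e2]].
  have /eqP[] : a1 != 0 :> hex by rewrite hex_neq0 //= Zp1_neq0.
  rewrite [LHS](_ : _ = (p + a1 - q) - (p + a2 - (q + a2))); last by ring.
  by rewrite e1 e2 !subrr.
have /eqP[] : a1 - a2 - a2 != 0 :> hex.
  by rewrite hex_neq0 //= oppr0 !addr0 Zp1_neq0.
rewrite [LHS](_ : _ = (p + a1 - (q + a2)) - (p + a2 - q)); last by ring.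
by rewrite e1 e2 !subrr.
Qed.

Definition flow_config u v : config m n :=
  [ffun e => if [pick p | e == hedge p] is Some p then u p
             else if [pick p | e == vedge p] is Some p then v p
             else if [pick p | e == dedge p] is Some p then - (u p + v p)
             else 0].

Lemma flow_config_h u v p : flow_config u v (hedge p) = u p.
Proof.
rewrite ffunE; case: pickP => [q /eqP/hedge_inj -> //|/(_ p)].
by rewrite eqxx.
Qed.

Lemma flow_config_v u v p : flow_config u v (vedge p) = v p.
Proof.
rewrite ffunE; case: pickP => [q|_];
  first by rewrite (negPf (vedge_neq_hedge _ _)).
by case: pickP => [q /eqP/vedge_inj -> //|/(_ p)]; rewrite eqxx.
Qed.

Lemma flow_config_d u v p : flow_config u v (dedge p) = - (u p + v p).
Proof.
rewrite ffunE; case: pickP => [q|_];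
  first by rewrite (negPf (dedge_neq_hedge _ _)).
case: pickP => [q|_]; first by rewrite (negPf (dedge_neq_vedge _ _)).
by case: pickP => [q /eqP/dedge_inj -> //|/(_ p)]; rewrite eqxx.
Qed.

Definition flow_h L : flow := [ffun p => L (hedge p)].
Definition flow_v L : flow := [ffun p => L (vedge p)].

Lemma star_A p : star (inl p : vertex m n) = [set hedge p; vedge p; dedge p].
Proof.
apply/setP => e; rewrite inE; apply/idP/idP; last first.
  by rewrite !inE => /orP[/orP[]|] /eqP ->;
    rewrite /= subUset !sub1set !inE !eqxx ?orbT.
have [x [y [/adjacent_neq xy eE]]] := edge_ends e.
rewrite eE subUset !sub1set /= !inE => /andP[].
by case/orP=> [/orP[]|] /eqP xE; case/orP=> [/orP[]|] /eqP yE; subst x y;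
  rewrite ?eqxx // in xy;
    rewrite -!val_eqE /= eE ?eqxx ?orbT // setUC ?eqxx ?orbT.
Qed.

Lemma star_B p : star (inr p : vertex m n) = [set dedge p; vedge (p + a1);
  hedge (p + a2)].
Proof.
apply/setP => e; rewrite inE; apply/idP/idP; last first.
  rewrite !inE => /orP[/orP[]|] /eqP ->;
    rewrite /= subUset !sub1set !inE ?eqxx ?orbT //.
  by rewrite [p + a2 + a1]addrAC eqxx orbT.
have [x [y [/adjacent_neq xy eE]]] := edge_ends e.
rewrite eE subUset !sub1set /= !inE => /andP[].
by case/orP=> [/orP[]|] /eqP xE; case/orP=> [/orP[]|] /eqP yE; subst x y;
  rewrite ?eqxx // in xy;
    rewrite -!val_eqE /= eE [p + a2 + a1]addrAC ?eqxx ?orbT // setUC ?eqxx ?orbT.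
Qed.

Lemma hedge_neq_vedge p q : hedge p != vedge q.
Proof. by rewrite eq_sym vedge_neq_hedge. Qed.

Lemma hedge_neq_dedge p q : hedge p != dedge q.
Proof. by rewrite eq_sym dedge_neq_hedge. Qed.

Lemma vedge_neq_dedge p q : vedge p != dedge q.
Proof. by rewrite eq_sym dedge_neq_vedge. Qed.

Definition all_allowed L := [forall v, allowed L v].

Lemma allowed_A L p : allowed L (inl p) =
  (L (hedge p) + L (vedge p) + L (dedge p) == 0)
  && ~~ [&& L (hedge p) == 0, L (vedge p) == 0 & L (dedge p) == 0].
Proof.
rewrite /allowed star_A forall_set3 big_set3 //.
- exact: hedge_neq_vedge.
- exact: hedge_neq_dedge.
- exact: vedge_neq_dedge.
Qed.

Lemma allowed_B L p : allowed L (inr p) =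
  (L (dedge p) + L (vedge (p + a1)) + L (hedge (p + a2)) == 0)
  && ~~ [&& L (dedge p) == 0, L (vedge (p + a1)) == 0 & L (hedge (p + a2)) == 0].
Proof.
rewrite /allowed star_B forall_set3 big_set3 //.
- exact: dedge_neq_vedge.
- exact: dedge_neq_hedge.
- exact: vedge_neq_hedge.
Qed.

Lemma all_allowed_flow L : all_allowed L ->
  allowed_flow (flow_h L) (flow_v L) /\ L = flow_config (flow_h L) (flow_v L).
Proof.
move=> /forallP allL.
have dE p : L (dedge p) = - (L (hedge p) + L (vedge p)).
  by have := allL (inl p); rewrite allowed_A => /andP[/eqP/addr0_eq ->].
split.
  split=> p; rewrite !ffunE.
  - have := allL (inr p); rewrite allowed_B dE => /andP[+ _].
    by rewrite -addrA addrC subr_eq0 addrC => /eqP.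
  - have := allL (inl p); rewrite allowed_A => /andP[_];
      apply: contra => /andP[h0 v0].
    by rewrite dE h0 v0 (eqP h0) (eqP v0) addr0 oppr0 eqxx.
  - have := allL (inr p); rewrite allowed_B => /andP[+];
      rewrite -addrA addr_eq0 => /eqP ->.
    by apply: contra => /andP[h0 v0];
      rewrite h0 v0 (eqP h0) (eqP v0) addr0 oppr0 eqxx.
apply/ffunP; elim/edge_cases => p.
- by rewrite flow_config_h ffunE.
- by rewrite flow_config_v ffunE.
- by rewrite flow_config_d !ffunE dE.
Qed.

Lemma all_allowed_flow_config u v : allowed_flow u v -> all_allowed (flow_config u v).
Proof.
move=> [uv uvA uvB]; apply/forallP => -[p|p].
- rewrite allowed_A flow_config_h flow_config_v flow_config_d subrr eqxx /=.
  by apply: contra (uvA p) => /and3P[-> ->].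
- rewrite allowed_B flow_config_h flow_config_v flow_config_d -addrA [v _ + _]addrC uv addNr eqxx /=.
  by apply: contra (uvB p) => /and3P[_ -> ->].
Qed.

Lemma N_hE L : N_h L = holonomy_h (flow_h L).
Proof.
transitivity (\sum_(e in [set hedge (i, 0) | i in [set: 'Z_m]]) L e).
  apply: eq_bigl => e; apply/existsP/imsetP => [[i /eqP ei]|[i _ ->]]; exists i.
  - by rewrite inE.
  - by apply: val_inj; rewrite ei /= /a1 hexD addr0.
  - by rewrite /= /a1 hexD addr0.
rewrite big_imset /=; last by move=> i j _ _ /hedge_inj[].
by apply: eq_big => i; rewrite ?inE // ffunE.
Qed.

Lemma N_vE L : N_v L = holonomy_v (flow_v L).
Proof.
transitivity (\sum_(e in [set vedge (0, i) | i in [set: 'Z_n]]) L e).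
  apply: eq_bigl => e; apply/existsP/imsetP => [[i /eqP ei]|[i _ ->]]; exists i.
  - by rewrite inE.
  - by apply: val_inj; rewrite ei /= /a2 hexD addr0.
  - by rewrite /= /a2 hexD addr0.
rewrite big_imset /=; last by move=> i j _ _ /vedge_inj[].
by apply: eq_big => i; rewrite ?inE // ffunE.
Qed.

End Edges.

Section Sectors.

Variables (m n : nat) (hm : (2 < m)%N) (hn : (2 < n)%N).

Notation hex := ('Z_m * 'Z_n)%type.
Notation flow := {ffun hex -> 'Z_3}.

Implicit Types (u v : flow) (p q P Q : hex) (L : config m n) (e PQ : edge m n).

Lemma edge_card e : #|val e| = 2.
Proof.
have [p [q [/(adjacent_neq hm hn) pq ->]]] := edge_ends e.
by rewrite cards2 pq.
Qed.

Lemma triple_card (w : vertex m n) : (#|triple w| <= 3)%N.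
Proof.
by case: w => p /=; rewrite setUC cardsU1 cards2;
  do 2!case: (_ != _) || case: (_ \notin _).
Qed.

Lemma touched_outer_uniq PQ (w : vertex m n) e e' : w \in touched PQ ->
    e \in star w -> e' \in star w -> e \notin inner PQ -> e' \notin inner PQ ->
  e = e'.
Proof.
rewrite !inE => /set0Pn[e0 /setIP[]]; rewrite !inE => e0w.
case/set0Pn => x /setIP[xe0 xPQ] ew e'w;
  rewrite !negbK => /eqP e_out /eqP e'_out.
have card_le : (#|triple w :\ x| <= 2)%N.
  by have := triple_card w; rewrite (cardsD1 x) (subsetP e0w _ xe0).
have full (f : edge m n) : val f \subset triple w -> val f :&: val PQ = set0 ->
    val f = triple w :\ x.
  move=> fw f0; apply/eqP; rewrite eqEcard edge_card card_le andbT.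
  rewrite subsetD1 fw; apply/negP => xf.
  by have := in_set0 x; rewrite -f0 inE xf xPQ.
apply: val_inj; exact: etrans (full e ew e_out) (esym (full e' e'w e'_out)).
Qed.

Lemma star_sub_inner_outer PQ (w : vertex m n) :
  w \in touched PQ -> star w \subset inner PQ :|: outer_legs PQ.
Proof.
move=> wt; apply/subsetP => e ew; rewrite inE [e \in outer_legs _]inE.
by case: (e \in inner PQ) => //=; apply/bigcupP; exists w.
Qed.

Lemma allowed_local L L' w : {in star w, L =1 L'} -> allowed L w = allowed L' w.
Proof.
move=> LL'; rewrite /allowed (eq_bigr L') //; congr (_ && ~~ _).
by apply: eq_forallb_in => e ew; rewrite LL'.
Qed.

Lemma folded_local L L' w : {in star w, L =1 L'} -> folded L w = folded L' w.
Proof. by case: w => p LL' /=; apply: eq_forallb_in => e ew; rewrite LL'. Qed.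

Lemma outer_determined PQ L L' :
    {in inner PQ, L =1 L'} ->
    (forall w, w \in touched PQ -> allowed L w) ->
    (forall w, w \in touched PQ -> allowed L' w) ->
  {in outer_legs PQ, L =1 L'}.
Proof.
move=> LL' La L'a e; rewrite inE => /andP[e_out /bigcupP[w wt ew]].
have /andP[/eqP s _] := La w wt; have /andP[/eqP s' _] := L'a w wt.
move: s; rewrite -[RHS]s' (bigD1 e) //= [RHS](bigD1 e) //=.
rewrite (eq_bigr L') => [/addIr //|f /andP[fw fe]].
apply: LL'; apply: contraNT fe => f_out.
by rewrite (touched_outer_uniq wt fw ew f_out e_out).
Qed.

Lemma N_h_local PQ L L' : all_allowed L -> all_allowed L' ->
  (forall e, e \notin inner PQ -> L e = L' e) -> N_h L = N_h L'.
Proof.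
move=> /(all_allowed_flow hm hn)[[uv _ _] _] /(all_allowed_flow hm hn)[[uv' _ _] _] LL'.
have [P [Q [_ PQE]]] := edge_ends PQ.
have [j jP jQ] := Zp_avoid hn P.2 Q.2.
rewrite !(N_hE hm) -(holonomy_h_row j uv) -(holonomy_h_row j uv').
apply: eq_bigr => i _; rewrite !ffunE; apply: LL'.
rewrite inE negbK PQE /= /a1 hexD addr0; apply/eqP/setP => x; rewrite !inE.
apply/negP => /andP[/orP[] /eqP -> /orP[] /eqP e];
by move: jP jQ; rewrite -e eqxx.
Qed.

Lemma N_v_local PQ L L' : all_allowed L -> all_allowed L' ->
  (forall e, e \notin inner PQ -> L e = L' e) -> N_v L = N_v L'.
Proof.
move=> /(all_allowed_flow hm hn)[[uv _ _] _] /(all_allowed_flow hm hn)[[uv' _ _] _] LL'.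
have [P [Q [_ PQE]]] := edge_ends PQ.
have [i iP iQ] := Zp_avoid hm P.1 Q.1.
rewrite !(N_vE hn) -(holonomy_v_column i uv) -(holonomy_v_column i uv').
apply: eq_bigr => j _; rewrite !ffunE; apply: LL'.
rewrite inE negbK PQE /= /a2 hexD addr0; apply/eqP/setP => x; rewrite !inE.
apply/negP => /andP[/orP[] /eqP -> /orP[] /eqP e];
by move: iP iQ; rewrite -e eqxx.
Qed.

Lemma sector_inhabited (s t : 'Z_3) :
  exists L : config m n, [/\ all_allowed L, N_h L = s & N_v L = t].
Proof.
have [x [y [x0 y0 xyE]]] : exists x y : 'Z_3, [/\ x != 0, y != 0 & x + y + (n - 2)%:R = t].
  suff [x [y [x0 y0 xyE]]] : exists x y : 'Z_3, [/\ x != 0, y != 0 & x + y = t - (n - 2)%:R].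
    by exists x, y; rewrite xyE subrK.
  by elim/Z3_ind: (t - _); [exists 1, 2 | exists 2, 2 | exists 1, 1];
    split=> //;
    apply: val_inj.
pose w (j : 'Z_n) : 'Z_3 := if j == 0 then x else if j == 1 then y else 1.
have w0 j : w j != 0 by rewrite /w; case: ifP => // _; case: ifP.
pose u : flow := [ffun p => if p.1 == 0 then s else 0].
pose v : flow := [ffun p => w p.2].
have uv : allowed_flow u v.
  apply: allowed_flow_straight => p; rewrite !ffunE //.
  by case: p => i j; rewrite /a1 /a2 !hexD !addr0.
exists (flow_config u v); split.
- exact: all_allowed_flow_config.
- rewrite (N_hE hm) /holonomy_h (bigD1 0) //= big1 => [|i i0].
    by rewrite ffunE flow_config_h // ffunE eqxx addr0.
  by rewrite ffunE flow_config_h // ffunE /= (negPf i0).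
- have vE j : flow_v (flow_config u v) (0, j) = w j.
    by rewrite ffunE flow_config_v // ffunE.
  rewrite (N_vE hn) /holonomy_v (bigD1 0) //= (bigD1 1) ?(Zp1_neq0 hn) //=.
  rewrite !vE /w !eqxx (negPf (Zp1_neq0 hn)) addrA -xyE.
  congr (_ + _); rewrite (eq_bigr (fun _ => 1)) => [|j /andP[/negPf j0 /negPf j1]]; last first.
    by rewrite vE /w j0 j1.
  rewrite sumr_const; congr _%:R.
  have := cardC (pred2 (0 : 'Z_n) 1);
    rewrite card2 eq_sym (Zp1_neq0 hn) card_ord.
  have := Zp_cast (ltnW hn); set c := #|[predC _]| => nE cE.
  have -> : (n - 2)%N = c by lia.
  by rewrite /c; apply: eq_card => j; rewrite !inE negb_or.
Qed.

Theorem sector_connected (T : Type) (F : config m n -> T) :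
    (forall PQ L L', all_allowed L -> all_allowed L' ->
       (forall e, e \notin inner PQ -> L e = L' e) -> F L = F L') ->
  forall L L', all_allowed L -> all_allowed L' ->
    N_h L = N_h L' -> N_v L = N_v L' -> F L = F L'.
Proof.
move=> F_local L L' /(all_allowed_flow hm hn)[uv LE] /(all_allowed_flow hm hn)[uv' LE'].
rewrite !(N_hE hm) !(N_vE hn) => hh hv; rewrite LE LE'.
apply: (invariant_connected hm hn (F := fun u v => F (flow_config u v))) => //.
move=> u v k P Q PQ uv1 uv2 kPQ.
pose e : edge m n := exist _ [set P; Q] (is_edge_adjacent PQ).
apply: (F_local e); try exact: all_allowed_flow_config.
have k0 p (f : edge m n) : p \in val f -> f \notin inner e -> k p = 0.
  move=> pf; rewrite inE negbK => /eqP f0; apply: kPQ; apply/eqP => pE;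
  by have := in_set0 p; rewrite -f0 inE pf pE /= !inE eqxx ?orbT.
elim/edge_cases => p p_out.
- rewrite !flow_config_h // ffunE !(k0 _ _ _ p_out) ?subrr ?addr0 // !inE eqxx ?orbT //.
- rewrite !flow_config_v // ffunE !(k0 _ _ _ p_out) ?subrr ?addr0 // !inE eqxx ?orbT //.
- rewrite !flow_config_d // !ffunE.
  have -> : k (p + a1) = 0 by rewrite (k0 _ _ _ p_out) // !inE eqxx.
  have -> : k (p + a2) = 0 by rewrite (k0 _ _ _ p_out) // !inE eqxx orbT.
  ring.
Qed.

End Sectors.

(** * Projectors and local operators *)

Section Projectors.

Local Open Scope sesquilinear_scope.

Variable C : numClosedFieldType.

Lemma trmxC_mul p q r (A : 'M[C]_(p, q)) (B : 'M[C]_(q, r)) :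
  (A *m B)^t* = B^t* *m A^t*.
Proof. by rewrite trmx_mul map_mxM. Qed.

Lemma projector_with_kernel_herm N (K : 'M[C]_N) :
  (projector_with_kernel K)^t* = projector_with_kernel K.
Proof.
rewrite /projector_with_kernel; set P := proj_ortho K.
have PK : (P <= K)%MS by rewrite -[P]mul1mx proj_ortho_sub.
have QP : (1%:M - P) *m P^t* = 0.
  have := proj_ortho_compl_sub K 1%:M; rewrite mul1mx => QK.
  by apply/orthomx1P; apply: submx_trans QK _; rewrite submx_ortho.
have PE : P^t* = P *m P^t*.
  by apply/eqP; rewrite -subr_eq0 -{1}[P^t*]mul1mx -mulmxBl QP.
have PH : P^t* = P.
  have PCK := trmxCK P.
  have e := etrans (trmxC_mul P (P^t*)) (congr1 (mulmx^~ (P^t*)) PCK).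
  exact: etrans PE (etrans (esym e) (etrans (esym (congr1 (fun A : 'M_N => A^t*) PE)) PCK)).
by rewrite linearB /= map_mxB PH trmx1 map_mx1.
Qed.

Lemma projector_with_kernel_idem N (K : 'M[C]_N) :
  projector_with_kernel K *m projector_with_kernel K = projector_with_kernel K.
Proof.
rewrite /projector_with_kernel mulmxBl mulmxBr mulmxBr !mulmx1 !mul1mx.
by rewrite proj_ortho_proj subrr subr0.
Qed.

Lemma projector_with_kernelP N (K : 'M[C]_N) (u : 'rV[C]_N) :
  reflect (u *m projector_with_kernel K = 0) (u <= K)%MS.
Proof.
rewrite /projector_with_kernel mulmxBr mulmx1; apply: (iffP idP) => [uK|/eqP].
  by rewrite proj_ortho_id ?subrr.
by rewrite subr_eq0 => /eqP ->; exact: proj_ortho_sub.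
Qed.

Lemma dotmx_hermitian_projector N (T : 'M[C]_N) (u : 'rV[C]_N) :
  T^t* = T -> T *m T = T -> dotmx (u *m T) u = dotmx (u *m T) (u *m T).
Proof.
move=> TH TT; rewrite !dotmxE trmxC_mul TH mulmxA.
by rewrite -[u *m T *m T]mulmxA TT.
Qed.

Section Sum.

Variables (N : nat) (I : finType) (T : I -> 'M[C]_N).
Hypotheses (T_herm : forall i, (T i)^t* = T i) (T_idem : forall i, T i *m T i = T i).

Lemma dotmx_sum_projectors (u : 'rV[C]_N) :
  dotmx (u *m \sum_i T i) u = \sum_i dotmx (u *m T i) (u *m T i).
Proof.
rewrite mulmx_sumr dotmxE mulmx_suml summxE; apply: eq_bigr => i _.
by rewrite -dotmx_hermitian_projector // dotmxE.
Qed.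

Lemma sum_projectors_kernel (u : 'rV[C]_N) :
  u *m (\sum_i T i) = 0 <-> (forall i, u *m T i = 0).
Proof.
split=> [u0 i|u0]; last by rewrite mulmx_sumr big1.
have := dotmx_sum_projectors u; rewrite u0 linear0l => /esym/eqP.
rewrite psumr_eq0 => [|j _]; last exact: dnorm_ge0.
by move=> /allP/(_ i (mem_index_enum i)); rewrite dnorm_eq0 => /eqP.
Qed.

Lemma sum_projectors_eigenvalue_ge0 (a : C) : eigenvalue (\sum_i T i) a -> 0 <= a.
Proof.
case/eigenvalueP => u ua u0; have := dotmx_sum_projectors u.
rewrite ua linearZl_LR /= => e.
rewrite -(pmulr_lge0 _ (_ : 0 < dotmx u u)) ?dnorm_gt0 // e.
by apply: sumr_ge0 => i _; exact: dnorm_ge0.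
Qed.

End Sum.

End Projectors.

Section LocalOperators.

Local Open Scope sesquilinear_scope.

Variables (m n : nat) (S : {set edge m n}).

Implicit Types (L : config m n) (e : edge m n).

Definition amplitude (F : Type) (T : finType) (c : states F T) (x : T) : F :=
  c 0 (enum_rank x).

Lemma states_ext (F : Type) (T : finType) (c c' : states F T) :
  amplitude c =1 amplitude c' -> c = c'.
Proof.
by move=> cc'; apply/rowP => i; have := cc' (enum_val i);
  rewrite /amplitude enum_valK.
Qed.

Lemma amplitude_superposition (F : Type) (T : finType) (f : T -> F) :
  amplitude (superposition f) =1 f.
Proof. by move=> x; rewrite /amplitude mxE enum_rankK. Qed.

Definition patch (x : local_config S) (L : config m n) : config m n :=
  [ffun e => if insub e is Some e' then x e' else L e].

Lemma patch_in x L e (eS : e \in S) : patch x L e = x (exist _ e eS).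
Proof. by rewrite ffunE insubT. Qed.

Lemma patch_out x L e : e \notin S -> patch x L e = L e.
Proof. by move=> eS; rewrite ffunE insubN. Qed.

Lemma restrictE L e (eS : e \in S) : restrict S L (exist _ e eS) = L e.
Proof. by rewrite ffunE. Qed.

Lemma restrict_patch x L : restrict S (patch x L) = x.
Proof. by apply/ffunP => -[e eS]; rewrite restrictE patch_in. Qed.

Lemma patch_patch x y L : patch x (patch y L) = patch x L.
Proof.
apply/ffunP => e; have [eS|eS] := boolP (e \in S); first by rewrite !patch_in.
by rewrite !patch_out.
Qed.

Lemma patch_restrict L L' : (forall e, e \notin S -> L e = L' e) ->
  patch (restrict S L) L' = L.
Proof.
move=> LL'; apply/ffunP => e; have [eS|eS] := boolP (e \in S).
  by rewrite patch_in restrictE.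
by rewrite patch_out // LL'.
Qed.

Definition slice (F : Type) (L : config m n) (c : states F (config m n)) :
  states F (local_config S) := superposition (fun x => amplitude c (patch x L)).

Lemma amplitude_slice (F : Type) L (c : states F (config m n)) x :
  amplitude (slice L c) x = amplitude c (patch x L).
Proof. exact: amplitude_superposition. Qed.

Lemma amplitude_act_on (F : nzRingType) (c : states F (config m n))
    (h : operators F (local_config S)) L :
  amplitude (c *m act_on h) L = amplitude (slice L c *m h) (restrict S L).
Proof.
rewrite /amplitude !mxE.
rewrite (reindex (@enum_rank (config m n))) /=;
  last exact/onW_bij/enum_rank_bij.
rewrite [RHS](reindex (@enum_rank (local_config S))) /=;
  last exact/onW_bij/enum_rank_bij.
under eq_bigr do rewrite mxE !enum_rankK.
under [RHS]eq_bigr do rewrite mxE enum_rankK.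
rewrite (bigID (fun L' : config m n => [forall e, (e \notin S) ==> (L' e == L e)])) /=.
rewrite [X in _ + X]big1 ?addr0 => [|L' /negPf ->]; last by rewrite mulr0.
have agree L' : [forall e, (e \notin S) ==> (L' e == L e)] ->
    forall e, e \notin S -> L' e = L e.
  by move=> /forallP L'L e eS; apply/eqP; have /implyP := L'L e; apply.
rewrite (reindex_onto (patch^~ L) (@restrict m n S)) /=; last first.
  by move=> L' /agree; exact: patch_restrict.
apply: eq_big => [x|x /andP[-> _]]; last by rewrite restrict_patch.
rewrite restrict_patch eqxx andbT; apply/forallP => e; apply/implyP => eS.
by rewrite patch_out.
Qed.

Lemma slice_act_on (F : nzRingType) (c : states F (config m n))
    (h : operators F (local_config S)) L :
  slice L (c *m act_on h) = slice L c *m h.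
Proof.
apply: states_ext => x; rewrite amplitude_slice amplitude_act_on restrict_patch.
congr (amplitude (_ *m h) x); apply: states_ext => y.
by rewrite !amplitude_slice patch_patch.
Qed.

Lemma act_on_eq0 (F : nzRingType) (c : states F (config m n))
    (h : operators F (local_config S)) :
  c *m act_on h = 0 <-> forall L, slice L c *m h = 0.
Proof.
split=> [c0 L|c0].
  rewrite -slice_act_on c0; apply: states_ext => x.
  by rewrite amplitude_slice /amplitude !mxE.
by apply: states_ext => L; rewrite amplitude_act_on c0 /amplitude !mxE.
Qed.

Lemma act_on_mul (F : nzRingType) (h h' : operators F (local_config S)) :
  act_on h *m act_on h' = act_on (h *m h').
Proof.
apply/row_matrixP => i; rewrite !rowE mulmxA; apply: states_ext => L.
by rewrite !amplitude_act_on slice_act_on mulmxA.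
Qed.

Lemma act_on_herm (C : numClosedFieldType) (h : operators C (local_config S)) :
  (act_on h)^t* = act_on (h^t*).
Proof.
apply/matrixP => i j; rewrite !mxE (fun_if Num.conj) rmorph0.
congr (if _ then _ else _); last by rewrite !mxE.
by apply: eq_forallb => e; rewrite [_ == enum_val i e]eq_sym.
Qed.

End LocalOperators.

Section Kernels.

Local Open Scope sesquilinear_scope.

Variables (C : numClosedFieldType) (m n : nat) (zeta : C).

Notation term S K := (act_on (projector_with_kernel K) : operators C (config m n)).

Lemma term_herm (S : {set edge m n}) (K : operators C (local_config S)) :
  (term S K)^t* = term S K.
Proof. by rewrite act_on_herm projector_with_kernel_herm. Qed.

Lemma term_idem (S : {set edge m n}) (K : operators C (local_config S)) :
  term S K *m term S K = term S K.
Proof. by rewrite act_on_mul projector_with_kernel_idem. Qed.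

Lemma term_kernel (S : {set edge m n}) (K : operators C (local_config S))
    (c : states C (config m n)) :
  c *m term S K = 0 <-> forall L, (slice S L c <= K)%MS.
Proof.
rewrite act_on_eq0; split=> cK L; first exact/projector_with_kernelP.
exact/projector_with_kernelP.
Qed.

Lemma hamiltonian_sum : hamiltonian m n zeta =
  \sum_(i : vertex m n + edge m n)
    match i with inl v => vertex_term C v | inr PQ => pair_term zeta PQ end.
Proof. by rewrite big_sumType. Qed.

Lemma hamiltonian_kernel (c : states C (config m n)) :
  c *m hamiltonian m n zeta = 0 <->
  (forall v, c *m vertex_term C v = 0) /\ (forall PQ, c *m pair_term zeta PQ = 0).
Proof.
rewrite hamiltonian_sum sum_projectors_kernel.
- split=> [c0|[cv cp] [v|PQ] //].
  by split=> i; [exact: (c0 (inl i)) | exact: (c0 (inr i))].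
- by case=> ?; exact: term_herm.
- by case=> ?; exact: term_idem.
Qed.

Lemma hamiltonian_eigenvalue_ge0 a : eigenvalue (hamiltonian m n zeta) a -> 0 <= a.
Proof.
rewrite hamiltonian_sum; apply: sum_projectors_eigenvalue_ge0; case=> ?;
by [exact: term_herm | exact: term_idem].
Qed.

End Kernels.

(** * The ground space *)

Section Spans.

Variables (F : fieldType) (T : finType).

Lemma sub_sum_genmx_rows (I : finType) (N : nat) (B : I -> 'rV[F]_N) (s : 'rV[F]_N) :
  (s <= \sum_i <<B i>>)%MS <-> exists a : I -> F, s = \sum_i a i *: B i.
Proof.
split=> [/sub_sumsmxP[u ->]|[a ->]]; last first.
  apply: summx_sub => i _; apply: scalemx_sub.
  by apply: (submx_trans _ (sumsmx_sup i _ (submx_refl _))); rewrite ?genmxE.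
have /fin_all_exists[a aE] : forall i, exists a, u i *m <<B i>>%MS = a *: B i.
  move=> i; apply/sub_rVP; rewrite (submx_trans (submxMl _ _)) // genmxE.
  exact: submx_refl.
by exists a; apply: eq_bigr => i _; exact: aE.
Qed.

Lemma sub_sum_kets (P : pred T) (s : states F T) :
  (s <= \sum_(x | P x) <<ket F x>>)%MS <->
  (forall x, ~~ P x -> amplitude s x = 0).
Proof.
split=> [/sub_sumsmxP[u ->] x Px|s0].
  rewrite /amplitude summxE big1 // => y Py.
  have : (u y *m <<ket F y>>%MS <= ket F y)%MS.
    by rewrite (submx_trans (submxMl _ _)) // genmxE submx_refl.
  case/sub_rVP => a ->; rewrite !mxE enum_rankK.
  by case: (eqVneq x y) Px => [->|_ _]; rewrite ?Py ?mulr0.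
have -> : s = \sum_(x | P x) amplitude s x *: ket F x.
  apply: states_ext => x; rewrite /amplitude summxE.
  have [Px|Px] := boolP (P x).
    rewrite (bigD1 x) //= big1 => [|y /andP[_ yx]].
      by rewrite !mxE enum_rankK eqxx mulr1 addr0.
    by rewrite !mxE enum_rankK eq_sym (negPf yx) mulr0.
  rewrite [LHS](s0 x Px) big1 // => y Py; rewrite !mxE enum_rankK.
  by case: (eqVneq x y) Px => [->|_ _]; rewrite ?Py ?mulr0.
apply: summx_sub => x Px; apply: scalemx_sub.
by apply: (submx_trans _ (sumsmx_sup x Px (submx_refl _))); rewrite genmxE.
Qed.

End Spans.

Section GroundStates.

Variables (C : numClosedFieldType) (m n : nat) (zeta : C).
Hypotheses (hm : (2 < m)%N) (hn : (2 < n)%N) (hzeta : zeta != 0).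

Implicit Types (L : config m n) (e PQ : edge m n) (v : vertex m n)
  (c : states C (config m n)).

Lemma glue_inl (S T : {set edge m n}) (x : local_config S) (r : local_config T) e
    (eS : e \in S) : glue x r e = x (exist _ e eS).
Proof. by rewrite ffunE insubT. Qed.

Lemma glue_inr (S T : {set edge m n}) (x : local_config S) (r : local_config T) e
    (eT : e \in T) : e \notin S -> glue x r e = r (exist _ e eT).
Proof. by move=> eS; rewrite ffunE insubN // insubT. Qed.

Lemma glue_restrict (S T : {set edge m n}) L :
  {in S :|: T, glue (restrict S L) (restrict T L) =1 L}.
Proof.
move=> e; have [eS _|eS] := boolP (e \in S);
  first by rewrite glue_inl restrictE.
by rewrite inE (negPf eS) /= => eT; rewrite (glue_inr _ _ eT) // restrictE.
Qed.

Lemma vertex_term_kernel c v : c *m vertex_term C v = 0 <->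
  forall L, ~~ allowed L v -> amplitude c L = 0.
Proof.
have glueE (x : local_config (star v)) L : allowed (glue x ([ffun=> 0] : local_config set0)) v
               = allowed (patch x L) v.
  by apply: allowed_local => e eS; rewrite glue_inl patch_in.
rewrite term_kernel; split=> [cK L Lv|c0 L].
  have /sub_sum_kets/(_ (restrict (star v) L)) := cK L.
  by rewrite amplitude_slice (glueE _ L) patch_restrict //; exact.
by apply/sub_sum_kets => x; rewrite amplitude_slice (glueE _ L); exact: c0.
Qed.

Definition folds L := #|[set v | folded L v]|.

Definition touched_folds PQ L := #|[set v in touched PQ | folded L v]|.
Definition untouched_folds PQ L := #|[set v | folded L v] :\: touched PQ|.

Lemma folds_split PQ L : folds L = (touched_folds PQ L + untouched_folds PQ L)%N.
Proof.
rewrite /folds -(cardsID (touched PQ)); congr (_ + _)%N.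
by apply: eq_card => v; rewrite !inE andbC.
Qed.

Lemma untouched_star PQ v L L' : v \notin touched PQ ->
  (forall e, e \notin inner PQ -> L e = L' e) -> {in star v, L =1 L'}.
Proof.
rewrite inE negbK => /eqP v0 LL' e ev; apply: LL'; apply/negP => e_in.
by have := in_set0 e; rewrite -v0 in_setI ev e_in.
Qed.

Lemma untouched_folds_local PQ L L' :
    (forall e, e \notin inner PQ -> L e = L' e) ->
  untouched_folds PQ L = untouched_folds PQ L'.
Proof.
move=> LL'; apply: eq_card => v; rewrite !in_setD.
have [//|vt /=] := boolP (v \in touched PQ).
by rewrite in_set [RHS]in_set (folded_local (untouched_star vt LL')).
Qed.

Lemma pair_state_touched PQ L (r : local_config (outer_legs PQ)) :
    (forall v, v \in touched PQ -> allowed L v) ->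
  amplitude (pair_state zeta r) (restrict (inner PQ) L) =
  if r == restrict (outer_legs PQ) L then zeta ^+ touched_folds PQ L else 0.
Proof.
move=> La; rewrite amplitude_superposition /=.
have starE v : v \in touched PQ ->
    {in star v, glue (restrict (inner PQ) L) (restrict (outer_legs PQ) L) =1 L}.
  move=> vt e ev; apply: glue_restrict.
  exact: subsetP (star_sub_inner_outer vt) _ ev.
case: eqP => [->|r_neq].
  rewrite ifT; last by apply/forall_inP => v vt;
    rewrite (allowed_local (starE v vt)) La.
  congr (_ ^+ _); apply: eq_card => v; rewrite in_set [RHS]in_set.
  by have [vt|//] := boolP (v \in touched PQ);
    rewrite (folded_local (starE v vt)).
case: forall_inP => // ga; case: r_neq; apply/ffunP => -[e e_out].
have e_notin : e \notin inner PQ by move: (e_out); rewrite inE => /andP[].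
rewrite restrictE -(glue_inr (restrict (inner PQ) L) r e_out e_notin).
apply/esym; apply: (outer_determined hm hn (PQ := PQ)) => // f f_in.
by rewrite glue_inl restrictE.
Qed.

Lemma pair_term_kernel c PQ :
    (forall L, ~~ all_allowed L -> amplitude c L = 0) ->
  c *m pair_term zeta PQ = 0 <->
  (forall L L', all_allowed L -> all_allowed L' ->
     (forall e, e \notin inner PQ -> L e = L' e) ->
     amplitude c L / zeta ^+ folds L = amplitude c L' / zeta ^+ folds L').
Proof.
move=> c_allowed; rewrite term_kernel; split=> [cK L L' La L'a LL'|cP L].
  have /sub_sum_genmx_rows[a aE] := cK L.
  have sliceE L1 : all_allowed L1 -> (forall e, e \notin inner PQ -> L1 e = L e) ->
      amplitude c L1 = a (restrict (outer_legs PQ) L) * zeta ^+ touched_folds PQ L1.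
    move=> L1a L1L; have <- : restrict (outer_legs PQ) L1 = restrict (outer_legs PQ) L.
      apply/ffunP => -[e e_out]; rewrite !restrictE; apply: L1L.
      by move: e_out; rewrite inE => /andP[].
    rewrite -{1}(patch_restrict L1L) -amplitude_slice aE /amplitude summxE.
    rewrite (bigD1 (restrict (outer_legs PQ) L1)) //= big1 => [|r r_neq].
      rewrite addr0 mxE; congr (_ * _).
      by rewrite [LHS]pair_state_touched ?eqxx // => v _; exact: (forallP L1a).
    rewrite mxE [X in _ * X](_ : _ = 0) ?mulr0 //.
    rewrite [LHS]pair_state_touched ?(negPf r_neq) // => v _.
    exact: (forallP L1a).
  rewrite !(folds_split PQ) (untouched_folds_local LL') !exprD.
  rewrite (sliceE L) // (sliceE L') // => [|e /LL' //].
  by rewrite !invfM !mulrA !mulfK ?expf_neq0.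
have [x0 x0a|none] := pickP (fun x : local_config (inner PQ) => all_allowed (patch x L)); last first.
  rewrite (_ : slice _ L c = 0) ?sub0mx //; apply: states_ext => x.
  by rewrite amplitude_slice c_allowed ?none // /amplitude mxE.
set L0 := patch x0 L in x0a.
apply/sub_sum_genmx_rows.
exists (fun r => if r == restrict (outer_legs PQ) L
  then amplitude c L0 / zeta ^+ folds L0 * zeta ^+ untouched_folds PQ L0 else 0).
apply: states_ext => x; rewrite amplitude_slice /amplitude summxE.
rewrite (bigD1 (restrict (outer_legs PQ) L)) //= big1 => [|r /negPf ->];
  last by rewrite scale0r mxE.
rewrite eqxx mxE addr0 -/(amplitude c (patch x L)).
set L1 := patch x L.
have L1L0 e : e \notin inner PQ -> L1 e = L0 e by move=> e_out;
  rewrite !patch_out.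
have rE : restrict (outer_legs PQ) L = restrict (outer_legs PQ) L1.
  apply/ffunP => -[e e_out]; rewrite !restrictE patch_out //.
  by move: e_out; rewrite inE => /andP[].
have xE : x = restrict (inner PQ) L1 by rewrite restrict_patch.
have [L1a|L1na] := boolP (all_allowed L1).
  have -> : pair_state zeta (restrict (outer_legs PQ) L) 0 (enum_rank x) = zeta ^+ touched_folds PQ L1.
    rewrite rE xE [LHS]pair_state_touched ?eqxx // => v _; exact: (forallP L1a).
  rewrite -(cP _ _ L1a x0a L1L0) -(untouched_folds_local L1L0) (folds_split PQ L1) exprD.
  by rewrite invfM !mulrA !divfK ?expf_neq0.
rewrite c_allowed // -[X in _ * X]/(amplitude _ x) amplitude_superposition /=.
case: forall_inP => [ga|]; last by rewrite mulr0.
case/negP: L1na; apply/forallP => v.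
have [vt|vt] := boolP (v \in touched PQ).
  rewrite (allowed_local (L' := glue x (restrict (outer_legs PQ) L))) ?ga // => e ev.
  by rewrite rE xE glue_restrict // (subsetP (star_sub_inner_outer vt) _ ev).
by rewrite (allowed_local (untouched_star vt L1L0)); exact: (forallP x0a).
Qed.

Theorem hamiltonian_kernelP c : c *m hamiltonian m n zeta = 0 <->
  (forall L, ~~ all_allowed L -> amplitude c L = 0) /\
  (forall PQ L L', all_allowed L -> all_allowed L' ->
     (forall e, e \notin inner PQ -> L e = L' e) ->
     amplitude c L / zeta ^+ folds L = amplitude c L' / zeta ^+ folds L').
Proof.
rewrite hamiltonian_kernel; split=> -[cv cp].
  have c_allowed L : ~~ all_allowed L -> amplitude c L = 0.
    by rewrite negb_forall => /existsP[v]; have /vertex_term_kernel := cv v;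
      exact.
  by split=> // PQ; exact/(pair_term_kernel PQ c_allowed).
split=> [v|PQ]; last by apply/(pair_term_kernel PQ cv); exact: cp.
apply/vertex_term_kernel => L Lv; apply: cv.
by apply: contra Lv => /forallP.
Qed.

End GroundStates.

Section GroundSpace.

Variables (C : numClosedFieldType) (m n : nat) (zeta : C).
Hypotheses (hm : (2 < m)%N) (hn : (2 < n)%N) (hzeta : zeta != 0).

Implicit Types (L : config m n) (i j : 'Z_3 * 'Z_3) (c : states C (config m n)).

Definition in_sector L i := [&& all_allowed L, N_h L == i.1 & N_v L == i.2].

Definition sector_state i : states C (config m n) :=
  superposition (fun L => if in_sector L i then zeta ^+ folds L else 0).

Lemma in_sector_inhabited i : exists L, in_sector L i.
Proof.
have [L [La Lh Lv]] := sector_inhabited hm hn i.1 i.2.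
by exists L; rewrite /in_sector La Lh Lv !eqxx.
Qed.

Lemma in_sectorE L i : all_allowed L -> in_sector L i = (i == (N_h L, N_v L)).
Proof.
by case: i => s t La; rewrite /in_sector La xpair_eqE /= (eq_sym s) (eq_sym t).
Qed.

Lemma amplitude_sector_sum (a : 'Z_3 * 'Z_3 -> C) L : all_allowed L ->
  amplitude (\sum_i a i *: sector_state i) L = a (N_h L, N_v L) * zeta ^+ folds L.
Proof.
move=> La; rewrite /amplitude summxE (bigD1 (N_h L, N_v L)) //= big1 => [|i iL].
  by rewrite !mxE enum_rankK in_sectorE // eqxx addr0.
by rewrite !mxE enum_rankK in_sectorE // (negPf iL) mulr0.
Qed.

Lemma amplitude_sector_sum0 (a : 'Z_3 * 'Z_3 -> C) L : ~~ all_allowed L ->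
  amplitude (\sum_i a i *: sector_state i) L = 0.
Proof.
move=> La; rewrite /amplitude summxE big1 // => i _.
by rewrite !mxE enum_rankK /in_sector (negPf La) mulr0.
Qed.

Lemma ground_state_sectors c : c *m hamiltonian m n zeta = 0 <->
  exists a : 'Z_3 * 'Z_3 -> C, c = \sum_i a i *: sector_state i.
Proof.
rewrite hamiltonian_kernelP //; split=> [[c0 c_loc]|[a ->]]; last first.
  split=> [L|PQ L L' La L'a LL']; first exact: amplitude_sector_sum0.
  rewrite !amplitude_sector_sum // !mulfK ?expf_neq0 //.
  by rewrite (N_h_local hm hn La L'a LL') (N_v_local hm hn La L'a LL').
have /fin_all_exists[rep repP] := in_sector_inhabited.
exists (fun i => amplitude c (rep i) / zeta ^+ folds (rep i)).
apply: states_ext => L; have [La|La] := boolP (all_allowed L); last first.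
  by rewrite c0 // amplitude_sector_sum0.
rewrite amplitude_sector_sum //; set i := (N_h L, N_v L).
have /and3P[Ra /eqP Rh /eqP Rv] := repP i.
rewrite (sector_connected hm hn (F := fun L => amplitude c L / zeta ^+ folds L) c_loc Ra La Rh Rv).
by rewrite divfK ?expf_neq0.
Qed.

Definition sector_matrix : 'M[C]_(#|{: 'Z_3 * 'Z_3}|, #|config m n|) :=
  \matrix_k sector_state (enum_val k).

Lemma mulmx_sector_matrix (u : 'rV[C]_#|{: 'Z_3 * 'Z_3}|) :
  u *m sector_matrix = \sum_i u 0 (enum_rank i) *: sector_state i.
Proof.
rewrite mulmx_sum_row (reindex (@enum_rank ('Z_3 * 'Z_3)%type)) /=; last first.
  exact/onW_bij/enum_rank_bij.
by apply: eq_bigr => i _; rewrite rowK enum_rankK.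
Qed.

Lemma eigenspace_sector_matrix :
  (eigenspace (hamiltonian m n zeta) 0 == sector_matrix)%MS.
Proof.
apply/andP; split; apply/rV_subP => c.
  move=> /eigenspaceP; rewrite scale0r => /ground_state_sectors[a ->].
  apply/submxP; exists (\row_k a (enum_val k)); rewrite mulmx_sector_matrix.
  by apply: eq_bigr => i _; rewrite mxE enum_rankK.
case/submxP => u ->; apply/eigenspaceP; rewrite scale0r.
by apply/ground_state_sectors; exists (fun i => u 0 (enum_rank i));
  exact: mulmx_sector_matrix.
Qed.

Lemma rank_ground_space : \rank (eigenspace (hamiltonian m n zeta) 0) = 9.
Proof.
rewrite (eqmx_rank eigenspace_sector_matrix).
have /eqP -> : row_free sector_matrix.
  apply: inj_row_free => u; rewrite mulmx_sector_matrix => u0; apply/rowP => k.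
  have [L Lk] := in_sector_inhabited (enum_val k).
  have /and3P[La _ _] := Lk;
    have := amplitude_sector_sum (fun i => u 0 (enum_rank i)) La.
  rewrite u0 [LHS]mxE; move: Lk; rewrite in_sectorE // => /eqP <-;
    rewrite enum_valK mxE.
  by move=> /esym/eqP;
    rewrite mulf_eq0 (negPf (expf_neq0 _ hzeta)) orbF => /eqP.
by rewrite card_prod !card_ord.
Qed.

Lemma ground_energy0 : ground_energy (hamiltonian m n zeta) 0.
Proof.
split; last exact: hamiltonian_eigenvalue_ge0.
by rewrite /eigenvalue -mxrank_eq0 rank_ground_space.
Qed.

Lemma foldsE L :
  folds L = (#|[set p | folded L (inl p)]| + #|[set p | folded L (inr p)]|)%N.
Proof.
by rewrite /folds -!sum1dep_card big_sumType.
Qed.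

End GroundSpace.

Section Characters.

Variables (F : fieldType) (w : F).
Hypotheses (w3 : w ^+ 3 = 1) (w1 : w != 1).

Lemma cube_root_primitive : 3.-primitive_root w.
Proof.
have [k k_prim k3] := prim_order_exists (isT : 0 < 3)%N w3.
have := dvdn_leq (isT : 0 < 3)%N k3;
  case: k k3 k_prim => [|[|[|[|k]]]] // _ k_prim _.
by move: w1; rewrite -[w]expr1 (prim_expr_order k_prim) eqxx.
Qed.

Lemma character_sum (s t : 'Z_3) :
  \sum_(a < 3) w ^+ (a * (3 - s)) * w ^+ (a * t) = if s == t then 3 else 0.
Proof.
under eq_bigr => a _ do rewrite -exprD -mulnDr mulnC exprM.
set q := w ^+ _; have q3 : q ^+ 3 = 1 by rewrite /q exprAC w3 expr1n.
have q1 : (q == 1) = (s == t).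
  rewrite -(prim_order_dvd cube_root_primitive).
  by move: s t {q q3}; do 2![case=> [[|[|[|//]]] ?]].
rewrite !big_ord_recr big_ord0 /= add0r expr0 expr1 -q1.
case: eqVneq => [->|nq]; first by rewrite expr1n -[1]/(1%:R) -!natrD.
apply: (mulfI (_ : q - 1 != 0)); first by rewrite subr_eq0.
by rewrite mulr0 (_ : _ * _ = q ^+ 3 - 1); [rewrite q3 subrr | ring].
Qed.

End Characters.

Section Omega.

Variable R : realType.

Lemma omega3 : omega R ^+ 3 = 1.
Proof.
set x : R := 2 * pi / 3.
have mul_cis a b : Complex (cos a) (sin a) * Complex (cos b) (sin b)
    = Complex (cos (a + b)) (sin (a + b)) :> R[i].
  by rewrite cosD sinD; congr Complex; ring.
have -> : omega R ^+ 3 = omega R * (omega R * omega R) by ring.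
rewrite /omega !mul_cis -/x (_ : x + (x + x) = pi *+ 2).
  by rewrite cos2pi sin2pi.
by rewrite /x -mulr_natr; field.
Qed.

Lemma omega_neq1 : omega R != 1.
Proof.
apply/eqP => -[_ sin0]; have : 0 < sin (2 * pi / 3 : R).
  by apply: sin_gt0_pi; have := pi_gt0 R; lra.
by rewrite sin0 ltxx.
Qed.

End Omega.

Section Siblings.

Variables (R : realType) (m n : nat) (zeta : R[i]).
Hypotheses (hm : (2 < m)%N) (hn : (2 < n)%N) (hzeta : zeta != 0).

Lemma amplitude_Psi (a b : 'I_3) (L : config m n) :
  amplitude (Psi m n zeta a b) L =
  if all_allowed L
  then omega R ^+ (a * N_h L) * omega R ^+ (b * N_v L) * zeta ^+ folds L else 0.
Proof. by rewrite amplitude_superposition -foldsE exprD. Qed.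

Lemma Psi_sectors (a b : 'I_3) :
  Psi m n zeta a b =
  \sum_(i : 'Z_3 * 'Z_3)
    (omega R ^+ (a * i.1) * omega R ^+ (b * i.2)) *: sector_state m n zeta i.
Proof.
apply: states_ext => L; rewrite amplitude_Psi; case: ifPn => La.
  by rewrite (amplitude_sector_sum _ (fun i : 'Z_3 * 'Z_3 => omega R ^+ (a * i.1) * omega R ^+ (b * i.2))).
by rewrite (amplitude_sector_sum0 _ (fun i : 'Z_3 * 'Z_3 => omega R ^+ (a * i.1) * omega R ^+ (b * i.2))).
Qed.

Lemma sector_state_Psi (i : 'Z_3 * 'Z_3) :
  sector_state m n zeta i =
  \sum_(a < 3) \sum_(b < 3)
    (9^-1 * omega R ^+ (a * (3 - i.1)) * omega R ^+ (b * (3 - i.2))) *: Psi m n zeta a b.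
Proof.
have ninth (F : numFieldType) (x : F) : 9^-1 * x * 3 * 3 = x by field.
have regroup (A : comNzRingType) (k z p1 q1 p2 q2 : A) :
  k * z * (p1 * q1) * (p2 * q2) = k * p1 * p2 * (q1 * q2 * z) by ring.
apply: states_ext => L; rewrite amplitude_superposition /amplitude summxE.
under eq_bigr do rewrite summxE.
under eq_bigr => a _ do under eq_bigr => b _ do rewrite mxE -/(amplitude _ L) amplitude_Psi.
have [La|La] := boolP (all_allowed L); last first.
  rewrite /in_sector (negPf La) /= big1 // => a _.
  by rewrite big1 // => b _; rewrite mulr0.
transitivity (9^-1 * zeta ^+ folds L
  * (\sum_(a < 3) omega R ^+ (a * (3 - i.1)) * omega R ^+ (a * N_h L))
  * (\sum_(b < 3) omega R ^+ (b * (3 - i.2)) * omega R ^+ (b * N_v L))).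
  rewrite !(character_sum (omega3 R) (omega_neq1 R)) in_sectorE //.
  case: i => s t /=; rewrite xpair_eqE; case: eqP => _; case: eqP => _ /=;
    rewrite ?mulr0 ?mul0r //.
  by rewrite ninth.
rewrite [X in X * _]mulr_sumr mulr_suml; apply: eq_bigr => a _.
rewrite mulr_sumr; apply: eq_bigr => b _; exact: regroup.
Qed.

End Siblings.

Theorem mainTheorem3 (R : realType) (m n : nat) (zeta : R[i])
    (hm : (3 <= m)%N) (hn : (3 <= n)%N) (hzeta : zeta != 0) :
  exists E0 : R[i],
    [/\ ground_energy (hamiltonian m n zeta) E0,
        \rank (eigenspace (hamiltonian m n zeta) E0) = 9%N
      & (eigenspace (hamiltonian m n zeta) E0
         == \sum_(nu_h < 3) \sum_(nu_v < 3) <<Psi m n zeta nu_h nu_v>>)%MS].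
Proof.
exists 0; split; [exact: ground_energy0 | exact: rank_ground_space |].
apply/andP; split.
  apply/rV_subP => c /eigenspaceP; rewrite scale0r => /(ground_state_sectors hm hn hzeta)[a ->].
  apply: summx_sub => i _; apply: scalemx_sub; rewrite sector_state_Psi.
  apply: summx_sub => nu_h _; apply: summx_sub => nu_v _; apply: scalemx_sub.
  apply: (submx_trans _ (sumsmx_sup nu_h isT (submx_refl _))).
  by apply: (submx_trans _ (sumsmx_sup nu_v isT (submx_refl _))); rewrite genmxE.
apply/sumsmx_subP => nu_h _; apply/sumsmx_subP => nu_v _; rewrite genmxE.
apply/eigenspaceP; rewrite scale0r; apply/(ground_state_sectors hm hn hzeta).
by rewrite Psi_sectors; exists (fun i : 'Z_3 * 'Z_3 => omega R ^+ (nu_h * i.1) * omega R ^+ (nu_v * i.2)).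
Qed.
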